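(* Every (normalized) Laurent polynomial $f\in\mathbb{C}[N]$, $N\cong\mathbb{Z}^2$, is mutation equivalent to a Laurent polynomial $g$ for which there exists a lattice point $v\in\Delta(g)$ with $\varphi_m(v)\le 0$ for every $m\in\mathcal{M}(g)$.
   Context: $M=\operatorname{Hom}(N,\mathbb{Z})$, $\widetilde M=M\oplus\mathbb{Z}$ with projections $\pi_M,\pi_{\mathbb{Z}}$, $R^*=(0,1)$. For $m\in\widetilde M$, $\varphi_m(n)=\langle\pi_M(m),n\rangle+\pi_{\mathbb{Z}}(m)$, and $(\pi_M(m)=0)=\{n:\langle\pi_M(m),n\rangle=0\}$. Laurent polynomials are normalized: coefficient $1$ at every vertex of the Newton polytope $\Delta(\cdot)$. For $g$ with $\Delta(g)\subset(\pi_M(m)=0)$, $f$ is $(m,g)$-mutable if $f=\sum_{i\in\mathbb{Z}}f_i$ with $f_i$ supported on $(\varphi_m=i)\cap N$ and $f_i$ divisible by $g^i$ (in the Laurent polynomial ring) for all $i\ge 0$; then $\operatorname{mut}^g_mf=\sum_if_i/g^i$. $f$ is $m$-mutable if $m\neq kR^*$ for all $k\in\mathbb{Z}$ and $f$ is $(m,g)$-mutable for some $g$ with $\Delta(g)\subset(\pi_M(m)=0)$ a lattice segment of lattice length $1$. $\mathcal{M}(f)=\{m\in\widetilde M: f\text{ is }m\text{-mutable}\}$. $f$ and $h$ are mutation equivalent if $h$ is obtained from $f$ by a finite sequence of mutations $\operatorname{mut}^{g}_{m}$, each applied to a polynomial that is $(m,g)$-mutable with $\Delta(g)$ a lattice segment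 of length $1$ in $(\pi_M(m)=0)$, $m\ne kR^*$. *)

(* Defs.v *)
From HB Require Import structures.
From mathcomp Require Import all_boot all_order all_algebra.
From mathcomp Require Import reals.
From mathcomp Require Import complex.
Set Implicit Arguments. Unset Strict Implicit. Unset Printing Implicit Defensive.
Import Order.TTheory GRing.Theory Num.Theory.
Local Open Scope ring_scope.

(* N = Z^2, M = Hom(N,Z) = Z^2 (via the standard pairing), M~ = M (+) Z. *)
Definition latN := (int * int)%type.
Definition latM := (int * int)%type.
Definition latMt := (latM * int)%type.  (* m = (pi_M m, pi_Z m); R^* = ((0,0),1) *)

Definition pairing (u : latM) (n : latN) : int := u.1 * n.1 + u.2 * n.2.
Definition addN (a b : latN) : latN := (a.1 + b.1, a.2 + b.2).

Definition phi (m : latMt) (n : latN) : int := pairing m.1 n + m.2.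

Section Laurent.
Variable R : realType.
Local Notation C := (complex R).

(* A Laurent polynomial in C[N] is represented by a finite list of
   (exponent, coefficient) pairs; its coefficient function is [coef]. Two
   lists represent the same Laurent polynomial iff [eqL] holds. *)
Definition laurent := seq (latN * C).

Definition coef (f : laurent) (n : latN) : C := \sum_(p <- f | p.1 == n) p.2.

Definition eqL (f h : laurent) : Prop := forall n, coef f n = coef h n.

Definition lmul (f h : laurent) : laurent :=
  [seq (addN p.1 q.1, p.2 * q.2) | p <- f, q <- h].

Definition lone : laurent := [:: ((0, 0), 1)].

Definition lpow (g : laurent) (i : nat) : laurent := iter i (lmul g) lone.

Definition suppl (f : laurent) : seq latN :=
  [seq p.1 | p <- f & coef f p.1 != 0].

Definition toR (n : latN) : R * R := (n.1%:~R, n.2%:~R).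

Definition in_conv (S : seq latN) (x : R * R) : Prop :=
  exists w : latN -> R,
    (forall s, 0 <= w s) /\ \sum_(s <- S) w s = 1 /\
    x.1 = \sum_(s <- S) w s * s.1%:~R /\ x.2 = \sum_(s <- S) w s * s.2%:~R.

Definition newton (f : laurent) (x : R * R) : Prop := in_conv (suppl f) x.

Definition vertex (f : laurent) (x : R * R) : Prop :=
  newton f x /\
  ~ (exists (a b : R * R) (t : R), newton f a /\ newton f b /\ a <> b /\
        0 < t < 1 /\ x.1 = t * a.1 + (1 - t) * b.1 /\ x.2 = t * a.2 + (1 - t) * b.2).

Definition normalized (f : laurent) : Prop :=
  forall n : latN, vertex f (toR n) -> coef f n = 1.

Definition seg_len1 (g : laurent) : Prop :=
  exists a b : latN, gcdz (b.1 - a.1) (b.2 - a.2) = 1%N /\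
    forall x, newton g x <-> in_conv [:: a; b] x.

Definition in_hyperplane (m : latMt) (g : laurent) : Prop :=
  forall n, coef g n != 0 -> pairing m.1 n = 0.

Definition restr (m : latMt) (f : laurent) (i : int) : laurent :=
  [seq p <- f | phi m p.1 == i].

Definition mutable_mg (m : latMt) (g f : laurent) : Prop :=
  forall i : nat, exists h : laurent, eqL (restr m f i%:Z) (lmul (lpow g i) h).

(* f' = mut^g_m f  (f being (m,g)-mutable): H i represents f_i / g^i *)
Definition is_mut (m : latMt) (g f f' : laurent) : Prop :=
  exists H : int -> laurent,
    (forall i : nat, eqL (restr m f i%:Z) (lmul (lpow g i) (H i%:Z))) /\
    (forall i : nat, H (Negz i) = lmul (restr m f (Negz i)) (lpow g i.+1)) /\
    (forall n, coef f' n =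
       \sum_(i <- undup [seq phi m p.1 | p <- f]) coef (H i) n).

Definition not_mult_Rstar (m : latMt) : Prop := forall k : int, m <> ((0, 0), k).

Definition admissible (m : latMt) (g : laurent) : Prop :=
  normalized g /\ in_hyperplane m g /\ seg_len1 g.

Definition m_mutable (m : latMt) (f : laurent) : Prop :=
  not_mult_Rstar m /\ exists g, admissible m g /\ mutable_mg m g f.

Definition mut_step (f f' : laurent) : Prop :=
  exists m g, not_mult_Rstar m /\ admissible m g /\ is_mut m g f f'.

Inductive mut_equiv : laurent -> laurent -> Prop :=
| mut_refl f : mut_equiv f f
| mut_trans f f' h : mut_step f f' -> mut_equiv f' h -> mut_equiv f h.

End Laurent.

(* Main.v *)
Require Import Defs.
From HB Require Import structures.
From mathcomp Require Import all_boot all_order all_algebra.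
From mathcomp Require Import boolp reals.
From mathcomp Require Import complex.
From mathcomp Require Import zify ring.
Set Implicit Arguments. Unset Strict Implicit. Unset Printing Implicit Defensive.
Import Order.TTheory GRing.Theory Num.Theory.
Local Open Scope ring_scope.

(** Only [m] with primitive linear part [u] matter.  For those, [m]-mutability says
    that the curve [f = 0] has multiplicity at least [h] (the maximum of [phi_m] on
    the polygon) at the point [-1] of the boundary divisor of normal [u], and the
    claim asks for a lattice point [v] at distance at least that multiplicity from
    every edge.  Among all polynomials mutation equivalent to [f], in all lattice
    bases, choose one of minimal width [w], say [0 <= x <= w], and then with the
    vertical edges as short as possible; the multiplicities on these edges are
    then at most [w / 2].  Enclose the polygon between optimal lines of integral
    slope above and below.  If the multiplicities [h], [h'] on these lines are at most
    [w / 2], a point of a middle column works, unless the polygon lies in a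
    unimodular triangle of size less than [3w / 2]; then minimality of [w] bounds
    every multiplicity and a point at equal distance from two sides works.  If [h]
    or [h'] exceeds [w / 2], the corresponding mutation cannot lower the width,
    and this forces enough room between the two lines, possibly after further
    mutations along the left edge. *)

(** One fact controls oblique normals: a nonzero row at height [i > 0] divisible by [(1 + z^e)^i]
    has lattice length at least [i]. A support point near a corner therefore settles every oblique
    normal there, and only the edges of the enclosing shape need real work. The bound [w / 2] on the
    vertical edges is a count: a left mutation of multiplicity [c] shortens the left edge by [c] and
    lengthens the right one by [w - c], while the total is minimal. On the top and bottom edges the
    tool is instead that the mutated polygon must still have extent [w] in every lattice direction.
    That [v] lies in the polygon costs nothing: if the support lies in [phi <= 0], the multiplicity
    condition for [phi] holds vacuously, so a form separating [v] from the polygon is itself a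
    violated constraint. *)

Section Arrays.

(** * Coefficient arrays and multiplication by powers of a binomial *)

Variable V : zmodType.
Implicit Types f g h : int -> int -> V.

Definition finite_supp f := exists B : int, forall x y, f x y != 0 ->
  -B <= x /\ x <= B /\ -B <= y /\ y <= B.

(* Multiplication by [1 + z^(a,b)] on coefficient arrays. *)
Definition mulp (a b : int) f : int -> int -> V := fun x y => f x y + f (x - a) (y - b).

Definition mulpn (a b : int) (i : nat) f := iter i (mulp a b) f.

Lemma mulpE a b f x y : mulp a b f x y = f x y + f (x - a) (y - b).
Proof. by []. Qed.

Lemma mulpnS a b i f x y : mulpn a b i.+1 f x y = mulpn a b i f x y + mulpn a b i f (x - a) (y - b).
Proof. by []. Qed.

Lemma mulpnD a b i j f : mulpn a b (i + j) f = mulpn a b i (mulpn a b j f).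
Proof. by rewrite /mulpn iterD. Qed.

Lemma addV_neq0 (u v : V) : u + v != 0 -> u != 0 \/ v != 0.
Proof.
by case: (eqVneq u 0) => [->|]; [rewrite add0r; right|left].
Qed.

Lemma mulpn_supp a b i f x y : mulpn a b i f x y != 0 ->
  exists2 j : nat, (j <= i)%N & f (x - a * j%:Z) (y - b * j%:Z) != 0.
Proof.
elim: i x y => [|i IH] x y.
  by move=> h; exists 0%N => //; rewrite !mulr0 !subr0.
rewrite mulpnS => /addV_neq0 [/IH [j ji hj]|/IH [j ji hj]].
  by exists j => //; apply: leqW.
exists j.+1 => //.
have -> : x - a * j.+1%:Z = x - a - a * j%:Z by lia.
by have -> : y - b * j.+1%:Z = y - b - b * j%:Z by lia.
Qed.

Lemma mulpn_ext a b i f g x y :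
  (forall j : nat, (j <= i)%N -> f (x - a * j%:Z) (y - b * j%:Z) = g (x - a * j%:Z) (y - b * j%:Z)) ->
  mulpn a b i f x y = mulpn a b i g x y.
Proof.
elim: i x y => [|i IH] x y h.
  by have := h 0%N isT; rewrite !mulr0 !subr0.
rewrite !mulpnS; congr (_ + _); apply: IH => j ji.
  by apply: h; apply: leqW.
have := h j.+1 ji.
have -> : x - a * j.+1%:Z = x - a - a * j%:Z by lia.
by have -> : y - b * j.+1%:Z = y - b - b * j%:Z by lia.
Qed.

Lemma mulpn_eq0 a b i f x y :
  (forall j : nat, (j <= i)%N -> f (x - a * j%:Z) (y - b * j%:Z) = 0) -> mulpn a b i f x y = 0.
Proof.
move=> h; apply/eqP/negPn/negP => /mulpn_supp [j ji].
by rewrite h // eqxx.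
Qed.

Lemma mulp_fin a b f : finite_supp f -> finite_supp (mulp a b f).
Proof.
move=> [B hB]; exists (B + `|a| + `|b|) => x y /addV_neq0 [/hB|/hB]; lia.
Qed.

Lemma mulpn_fin a b i f : finite_supp f -> finite_supp (mulpn a b i f).
Proof. by move=> hf; elim: i => // i IH; apply: mulp_fin. Qed.

Lemma fin_escape (a b x y : int) f : (a != 0) || (b != 0) -> finite_supp f ->
  exists s0 : nat, forall s : int, s0%:Z <= `|s| -> f (x + a * s) (y + b * s) = 0.
Proof.
move=> ab [B hB]; exists (absz x + absz y + absz B + 1)%N => s hs.
apply/eqP/negPn/negP => /hB.
case/orP: ab => h.
  have : `|s| <= `|a * s| by rewrite normrM ler_peMl //; lia.
  by lia.
have : `|s| <= `|b * s| by rewrite normrM ler_peMl //; lia.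
by lia.
Qed.

(** Walk backwards to a nonzero coefficient preceded by a zero: there only one summand of the
    product contributes. *)
Lemma mulp_left a b f x y : (a != 0) || (b != 0) -> finite_supp f -> f x y != 0 ->
  exists s : nat, mulp a b f (x - a * s%:Z) (y - b * s%:Z) != 0.
Proof.
move=> ab hf fxy.
have [s0 hs0] := fin_escape x y ab hf.
suff [s [h1 h2]] : exists s : nat, f (x - a * s%:Z) (y - b * s%:Z) != 0
   /\ f (x - a * s.+1%:Z) (y - b * s.+1%:Z) = 0.
  exists s; rewrite /mulp.
  have -> : x - a * s%:Z - a = x - a * s.+1%:Z by lia.
  have -> : y - b * s%:Z - b = y - b * s.+1%:Z by lia.
  by rewrite h2 addr0.
apply: contrapT => hn.
have H : forall s : nat, f (x - a * s%:Z) (y - b * s%:Z) != 0.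
  elim=> [|s IH]; first by rewrite !mulr0 !subr0.
  by apply/negP => /eqP h; apply: hn; exists s.
have /eqP := hs0 (- s0%:Z) ltac:(lia).
rewrite !mulrN; exact/negP.
Qed.

Lemma mulp_right a b f x y : (a != 0) || (b != 0) -> finite_supp f -> f x y != 0 ->
  exists s : nat, mulp a b f (x + a * s.+1%:Z) (y + b * s.+1%:Z) != 0.
Proof.
move=> ab hf fxy.
have [s0 hs0] := fin_escape x y ab hf.
suff [s [h1 h2]] : exists s : nat, f (x + a * s%:Z) (y + b * s%:Z) != 0
   /\ f (x + a * s.+1%:Z) (y + b * s.+1%:Z) = 0.
  exists s; rewrite /mulp h2 add0r.
  have -> : x + a * s.+1%:Z - a = x + a * s%:Z by lia.
  by have -> : y + b * s.+1%:Z - b = y + b * s%:Z by lia.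
apply: contrapT => hn.
have H : forall s : nat, f (x + a * s%:Z) (y + b * s%:Z) != 0.
  elim=> [|s IH]; first by rewrite !mulr0 !addr0.
  by apply/negP => /eqP h; apply: hn; exists s.
have /eqP := hs0 s0%:Z ltac:(lia).
exact/negP.
Qed.

Lemma mulpn_left a b i f x y : (a != 0) || (b != 0) -> finite_supp f -> f x y != 0 ->
  exists s : nat, mulpn a b i f (x - a * s%:Z) (y - b * s%:Z) != 0.
Proof.
move=> ab hf fxy; elim: i => [|i [s IH]].
  by exists 0%N; rewrite !mulr0 !subr0.
have [t ht] := mulp_left ab (mulpn_fin a b i hf) IH.
exists (s + t)%N.
have -> : x - a * (s + t)%:Z = x - a * s%:Z - a * t%:Z by lia.
by have -> : y - b * (s + t)%:Z = y - b * s%:Z - b * t%:Z by lia.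
Qed.

Lemma mulpn_right a b i f x y : (a != 0) || (b != 0) -> finite_supp f -> f x y != 0 ->
  exists s : nat, (i <= s)%N /\ mulpn a b i f (x + a * s%:Z) (y + b * s%:Z) != 0.
Proof.
move=> ab hf fxy; elim: i => [|i [s [si IH]]].
  by exists 0%N; rewrite !mulr0 !addr0.
have [t ht] := mulp_right ab (mulpn_fin a b i hf) IH.
exists (s + t.+1)%N; split; first by lia.
have -> : x + a * (s + t.+1)%:Z = x + a * s%:Z + a * t.+1%:Z by lia.
by have -> : y + b * (s + t.+1)%:Z = y + b * s%:Z + b * t.+1%:Z by lia.
Qed.

Lemma mulp_add a b f g : mulp a b (fun x y => f x y + g x y) = fun x y => mulp a b f x y + mulp a b g x y.
Proof. by apply/funext => x; apply/funext => y; rewrite /mulp addrACA. Qed.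

Lemma mulpn_add a b i f g : mulpn a b i (fun x y => f x y + g x y) = fun x y => mulpn a b i f x y + mulpn a b i g x y.
Proof.
elim: i => // i IH; rewrite /mulpn /= -/(mulpn a b i _) IH.
by rewrite mulp_add.
Qed.

Lemma mulp_sub a b f g : mulp a b (fun x y => f x y - g x y) = fun x y => mulp a b f x y - mulp a b g x y.
Proof. by apply/funext => x; apply/funext => y; rewrite /mulp opprD addrACA. Qed.

Lemma mulpn_sub a b i f g : mulpn a b i (fun x y => f x y - g x y) = fun x y => mulpn a b i f x y - mulpn a b i g x y.
Proof.
elim: i => // i IH; rewrite /mulpn /= -/(mulpn a b i _) IH.
by rewrite mulp_sub.
Qed.

Lemma fin_sub f g : finite_supp f -> finite_supp g -> finite_supp (fun x y => f x y - g x y).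
Proof.
move=> [B hB] [C hC]; exists (`|B| + `|C|) => x y /addV_neq0 [/hB|]; first by lia.
by rewrite oppr_eq0 => /hC; lia.
Qed.

Lemma fin_add f g : finite_supp f -> finite_supp g -> finite_supp (fun x y => f x y + g x y).
Proof.
move=> [B hB] [C hC]; exists (`|B| + `|C|) => x y /addV_neq0 [/hB|/hC]; lia.
Qed.

(** Cancellation is stated on a single line because mutations divide different rows by different
    powers. *)
Lemma mulpn_inj_line a b i f g (x y : int) : (a != 0) || (b != 0) -> finite_supp f -> finite_supp g ->
  (forall t : int, mulpn a b i f (x + a * t) (y + b * t) = mulpn a b i g (x + a * t) (y + b * t)) ->
  forall t : int, f (x + a * t) (y + b * t) = g (x + a * t) (y + b * t).
Proof.
move=> ab hf hg H t; apply/eqP; rewrite -subr_eq0; apply/negPn/negP => hn.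
have [s] := mulpn_left i ab (fin_sub hf hg) hn.
rewrite mulpn_sub.
have -> : x + a * t - a * s%:Z = x + a * (t - s%:Z) by lia.
have -> : y + b * t - b * s%:Z = y + b * (t - s%:Z) by lia.
by rewrite H subrr eqxx.
Qed.

Lemma mulpn_rev a b i f x y : mulpn (-a) (-b) i f x y = mulpn a b i f (x + a * i%:Z) (y + b * i%:Z).
Proof.
elim: i x y => [|i IH] x y; first by rewrite !mulr0 !addr0.
rewrite !mulpnS !IH !opprK addrC; congr (_ + _).
  by congr (mulpn _ _ _ _ _ _); lia.
by congr (mulpn _ _ _ _ _ _); lia.
Qed.

Lemma mulpnC a b c d i j f : mulpn a b i (mulpn c d j f) = mulpn c d j (mulpn a b i f).
Proof.
have H1 : forall g, mulp a b (mulp c d g) = mulp c d (mulp a b g).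
  move=> g; apply/funext => x; apply/funext => y; rewrite /mulp addrACA.
  by rewrite ![_ - a - c]addrAC ![_ - b - d]addrAC.
have H2 : forall g, mulp a b (mulpn c d j g) = mulpn c d j (mulp a b g).
  by move=> g; elim: j => // j IH; rewrite /mulpn /= -/(mulpn c d j _) H1 IH.
elim: i => // i IH.
by rewrite /mulpn /= -/(mulpn a b i _) -/(mulpn c d j _) -/(mulpn a b i _) IH H2.
Qed.

End Arrays.

(** * Mutations and multiplicities of arrays *)

Section Mut.
Variable V : zmodType.
Implicit Types f g h : int -> int -> V.

(* For [(a, b)] orthogonal to [(p, q)]: the row of [f] at height [i > 0] of the
   affine form [(p, q, c)] is divisible by [(1 + z^(a,b))^i].  Geometrically, the
   curve [f = 0] has multiplicity [max + c] at the point [z^(a,b) = -1] of the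
   toric boundary divisor with normal [(p, q)]. *)
Definition has_mult_dir f (p q c a b : int) := exists2 g, finite_supp g &
  forall x y (i : nat), p * x + q * y + c = i.+1%:Z -> f x y = mulpn a b i.+1 g x y.

Definition has_mult f (p q c : int) := has_mult_dir f p q c q (- p).

(* [g] is the mutation of [f]; the relation is symmetric up to negating [(p, q, c)]. *)
Definition mutation_rel f g (p q c a b : int) := forall x y (i : nat),
  (p * x + q * y + c = i%:Z -> f x y = mulpn a b i g x y) /\
  (p * x + q * y + c = - i%:Z -> g x y = mulpn a b i f x y).

(** Finiteness of arrays patched together row by row: each row is shifted by at most its height plus
    one, and the height is constant along [(a, b)]. *)
Lemma fin_patch f g (p q c a b : int) : finite_supp f -> p * a + q * b = 0 ->
  (forall x y, g x y != 0 -> exists j : int, `|j| <= `|p * x + q * y + c| + 1 /\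
     f (x - a * j) (y - b * j) != 0) -> finite_supp g.
Proof.
move=> [B hB] ab H.
pose M := `|p| * B + `|q| * B + `|c| + 1.
exists (B + `|a| * M + `|b| * M) => x y /H [j [hj /hB]].
set u := x - a * j; set v := y - b * j => huv.
have B0 : 0 <= B by lia.
have e : p * x + q * y + c = p * u + q * v + c.
  rewrite /u /v; have -> : p * (x - a * j) + q * (y - b * j) = p * x + q * y - (p * a + q * b) * j by ring.
  by rewrite ab mul0r subr0.
have h1 : `|p * u| <= `|p| * B by rewrite normrM ler_wpM2l //; lia.
have h2 : `|q * v| <= `|q| * B by rewrite normrM ler_wpM2l //; lia.
have hM : `|j| <= M by rewrite /M; lia.
have h3 : `|a * j| <= `|a| * M by rewrite normrM ler_wpM2l.
have h4 : `|b * j| <= `|b| * M by rewrite normrM ler_wpM2l.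
have ex : x = u + a * j by rewrite /u; lia.
have ey : y = v + b * j by rewrite /v; lia.
move: h3 h4; rewrite ex ey; move: (a * j) (b * j) (`|a| * M) (`|b| * M) => A1 A2 M1 M2.
clear -huv; lia.
Qed.

Lemma has_mult_mutation_rel f p q c a b : finite_supp f -> p * a + q * b = 0 -> has_mult_dir f p q c a b ->
  exists2 g, finite_supp g & mutation_rel f g p q c a b.
Proof.
move=> hf ab [g hg H].
pose F x y := if 0 < p * x + q * y + c then g x y
  else mulpn a b (absz (p * x + q * y + c)) f x y.
have row x y (j : nat) : p * (x - a * j%:Z) + q * (y - b * j%:Z) = p * x + q * y.
  have -> : p * (x - a * j%:Z) + q * (y - b * j%:Z) = p * x + q * y - (p * a + q * b) * j%:Z by ring.
  by rewrite ab mul0r subr0.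
have eqF x y : 0 < p * x + q * y + c -> F x y = g x y by rewrite /F => ->.
exists F.
  pose G x y := if 0 < p * x + q * y + c then 0
    else mulpn a b (absz (p * x + q * y + c)) f x y.
  have hG : finite_supp G.
    apply: (@fin_patch f G p q c a b) => // x y; rewrite /G; case: ifP; first by rewrite eqxx.
    by move=> _ /mulpn_supp [j hj hfj]; exists j%:Z; split => //; lia.
  case: hg => B hB; case: hG => C hC; exists (`|B| + `|C|) => x y.
  rewrite /F; case: ifP => h; first by move=> /hB; lia.
  by move=> h0; have := hC x y; rewrite /G h => /(_ h0); lia.
move=> x y i; split => e.
  case: i e => [|i] e.
    by rewrite /mulpn /= /F e ltxx.
  rewrite (H _ _ _ e); apply: mulpn_ext => j _.
  by rewrite eqF // row e.
by rewrite /F e; case: i e => [|i] e //=.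
Qed.

Lemma mutation_rel_sym f g p q c a b : mutation_rel f g p q c a b -> mutation_rel g f (-p) (-q) (-c) a b.
Proof.
move=> H x y i; split => e; apply H; lia.
Qed.

(** Hull of a row under mutation: the near end stays, the far end retreats by the height of the row,
    or advances when the height is negative. *)
Lemma mutation_rel_supp f g p q c a b x y : finite_supp g -> (a != 0) || (b != 0) -> p * a + q * b = 0 ->
  mutation_rel f g p q c a b -> g x y != 0 ->
  (exists s : nat, f (x - a * s%:Z) (y - b * s%:Z) != 0) /\
  (exists s : int, p * x + q * y + c <= s /\ f (x + a * s) (y + b * s) != 0).
Proof.
move=> hg ab0 ab H gxy.
have row (j : int) : p * (x + a * j) + q * (y + b * j) = p * x + q * y.
  have -> : p * (x + a * j) + q * (y + b * j) = p * x + q * y + (p * a + q * b) * j by ring.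
  by rewrite ab mul0r addr0.
have [h0|h0] := leP 0 (p * x + q * y + c).
  have E (j : int) : f (x + a * j) (y + b * j)
     = mulpn a b (absz (p * x + q * y + c)) g (x + a * j) (y + b * j).
    by apply H; rewrite row gez0_abs.
  have [s hs] := mulpn_left (absz (p * x + q * y + c)) ab0 hg gxy.
  have [t [ht hts]] := mulpn_right (absz (p * x + q * y + c)) ab0 hg gxy.
  split; [exists s|exists t%:Z].
    by have := E (- s%:Z); rewrite !mulrN => ->.
  by split; [lia|rewrite E].
have e : g x y = mulpn a b (absz (p * x + q * y + c)) f x y by apply H; lia.
move: gxy; rewrite e => /mulpn_supp [j hj hfj].
split; first by exists j.
exists (- j%:Z); split; first by lia.
by rewrite !mulrN.
Qed.

Lemma has_mult_dir_row f p q c a b x y : (a != 0) || (b != 0) -> p * a + q * b = 0 ->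
  has_mult_dir f p q c a b -> f x y != 0 -> 0 < p * x + q * y + c ->
  exists t1 t2 : int, f (x + a * t1) (y + b * t1) != 0 /\ f (x + a * t2) (y + b * t2) != 0 /\
    t1 <= t2 /\ p * x + q * y + c <= t2 - t1.
Proof.
move=> ab0 ab [g hg H] fxy h0.
have row (j : int) : p * (x + a * j) + q * (y + b * j) = p * x + q * y.
  have -> : p * (x + a * j) + q * (y + b * j) = p * x + q * y + (p * a + q * b) * j by ring.
  by rewrite ab mul0r addr0.
have [i ei] : exists i : nat, p * x + q * y + c = i.+1%:Z.
  by exists (absz (p * x + q * y + c)).-1; lia.
have E (j : int) : f (x + a * j) (y + b * j) = mulpn a b i.+1 g (x + a * j) (y + b * j).
  by apply H; rewrite row.
have := fxy; rewrite (H _ _ _ ei) => /mulpn_supp [j _ gj].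
have [s hs] := mulpn_left i.+1 ab0 hg gj.
have [t [ht hts]] := mulpn_right i.+1 ab0 hg gj.
exists (- j%:Z - s%:Z), (- j%:Z + t%:Z); rewrite !E; split; [|split; [|lia]].
  have -> : x + a * (- j%:Z - s%:Z) = x - a * j%:Z - a * s%:Z by lia.
  by have -> : y + b * (- j%:Z - s%:Z) = y - b * j%:Z - b * s%:Z by lia.
have -> : x + a * (- j%:Z + t%:Z) = x - a * j%:Z + a * t%:Z by lia.
by have -> : y + b * (- j%:Z + t%:Z) = y - b * j%:Z + b * t%:Z by lia.
Qed.

(** [(1 + z^e)^i] is [z^(i e)] times [(1 + z^-e)^i], so the quotient is shifted along each row by
    its height. *)
Lemma has_mult_dir_rev f p q c a b : p * a + q * b = 0 -> has_mult_dir f p q c a b -> has_mult_dir f p q c (-a) (-b).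
Proof.
move=> ab [g hg H].
pose G x y := g (x - a * (p * x + q * y + c)) (y - b * (p * x + q * y + c)).
exists G.
  apply: (@fin_patch g G p q c a b) => // x y; rewrite /G => h.
  by exists (p * x + q * y + c); split => //; lia.
move=> x y i e; rewrite mulpn_rev (H _ _ _ e).
rewrite -[in LHS](addrK (a * i.+1%:Z) x) -[in LHS](addrK (b * i.+1%:Z) y).
have : forall X Y, p * X + q * Y + c = i.+1%:Z ->
   mulpn a b i.+1 g (X - a * i.+1%:Z) (Y - b * i.+1%:Z) = mulpn a b i.+1 G X Y.
  move=> X Y E.
  pose g1 X Y := g (X - a * i.+1%:Z) (Y - b * i.+1%:Z).
  have tr k U W : mulpn a b k g1 U W = mulpn a b k g (U - a * i.+1%:Z) (W - b * i.+1%:Z).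
    elim: k U W => // k IH U W; rewrite !mulpnS !IH; congr (_ + mulpn _ _ _ _ _ _).
      by rewrite addrAC.
    by rewrite addrAC.
  rewrite -tr; apply: mulpn_ext => j _; rewrite /g1 /G.
  have -> : p * (X - a * j%:Z) + q * (Y - b * j%:Z) + c = p * X + q * Y + c - (p * a + q * b) * j%:Z by ring.
  by rewrite ab mul0r subr0 E.
apply.
have -> : p * (x + a * i.+1%:Z) + q * (y + b * i.+1%:Z) + c = p * x + q * y + c + (p * a + q * b) * i.+1%:Z by ring.
by rewrite ab mul0r addr0.
Qed.

Definition aff (a b c d e e' : int) f : int -> int -> V :=
  fun x y => f (a * x + b * y + e) (c * x + d * y + e').

Lemma mulpn_aff a b c d e e' u v i f x y :
  mulpn u v i (aff a b c d e e' f) x y =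
  mulpn (a * u + b * v) (c * u + d * v) i f (a * x + b * y + e) (c * x + d * y + e').
Proof.
elim: i x y => // i IH x y; rewrite !mulpnS !IH; congr (_ + mulpn _ _ _ _ _ _); ring.
Qed.

Lemma fin_aff a b c d e e' f : a * d - b * c = 1 \/ a * d - b * c = -1 -> finite_supp f ->
  finite_supp (aff a b c d e e' f).
Proof.
move=> D [B hB].
exists ((`|a| + `|b| + `|c| + `|d|) * (B + `|e| + `|e'|)) => x y /hB.
set X := a * x + b * y + e; set Y := c * x + d * y + e' => h.
have B0 : 0 <= B by lia.
pose X' := X - e; pose Y' := Y - e'.
have hX' : `|X'| <= B + `|e| + `|e'| by rewrite /X'; lia.
have hY' : `|Y'| <= B + `|e| + `|e'| by rewrite /Y'; lia.
set M := B + `|e| + `|e'| in hX' hY' *.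
have ex : (a * d - b * c) * x = d * X' - b * Y' by rewrite /X' /Y' /X /Y; ring.
have ey : (a * d - b * c) * y = a * Y' - c * X' by rewrite /X' /Y' /X /Y; ring.
have k (u v u' v' : int) : `|v| <= M -> `|v'| <= M -> `|u * v - u' * v'| <= (`|u| + `|u'|) * M.
  move=> hv hv'; apply: le_trans (ler_normB _ _) _.
  by rewrite !normrM mulrDl lerD // ler_wpM2l.
have ax : `|x| = `|d * X' - b * Y'| by rewrite -ex; case: D => ->; rewrite ?mul1r // mulN1r normrN.
have ay : `|y| = `|a * Y' - c * X'| by rewrite -ey; case: D => ->; rewrite ?mul1r // mulN1r normrN.
have M0 : 0 <= M by lia.
have kx : `|x| <= (`|a| + `|b| + `|c| + `|d|) * M.
  by rewrite ax; apply: le_trans (k _ _ _ _ hX' hY') _; rewrite ler_wpM2r //; clear; lia.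
have ky : `|y| <= (`|a| + `|b| + `|c| + `|d|) * M.
  by rewrite ay; apply: le_trans (k _ _ _ _ hY' hX') _; rewrite ler_wpM2r //; clear; lia.
move: kx ky; set Z := (_ * M); clear; lia.
Qed.

Lemma has_mult_dir_aff f p q k u v a b c d e e' :
  a * d - b * c = 1 \/ a * d - b * c = -1 ->
  has_mult_dir f p q k (a * u + b * v) (c * u + d * v) ->
  has_mult_dir (aff a b c d e e' f) (p * a + q * c) (p * b + q * d) (k + p * e + q * e') u v.
Proof.
move=> D [g hg H]; exists (aff a b c d e e' g); first exact: fin_aff.
move=> x y i E; rewrite mulpn_aff /aff; apply: H; rewrite -E; ring.
Qed.

Lemma has_mult_aff f p q k a b c d e e' :
  a * d - b * c = 1 \/ a * d - b * c = -1 -> has_mult f p q k ->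
  has_mult (aff a b c d e e' f) (p * a + q * c) (p * b + q * d) (k + p * e + q * e').
Proof.
move=> D H; apply: has_mult_dir_aff => //.
have -> : a * (p * b + q * d) + b * - (p * a + q * c) = q * (a * d - b * c) by ring.
have -> : c * (p * b + q * d) + d * - (p * a + q * c) = - p * (a * d - b * c) by ring.
case: D => ->; first by rewrite !mulr1.
by rewrite !mulrN1; apply: has_mult_dir_rev => //; ring.
Qed.

Lemma mutation_rel_aff f g p q k u v a b c d e e' :
  mutation_rel f g p q k (a * u + b * v) (c * u + d * v) ->
  mutation_rel (aff a b c d e e' f) (aff a b c d e e' g) (p * a + q * c) (p * b + q * d) (k + p * e + q * e') u v.
Proof.
move=> H x y i; split => E; rewrite mulpn_aff /aff; apply H; rewrite -E; ring.
Qed.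

Definition unimodular (p q : int) := exists u v : int, u * p + v * q = 1.

(* [v] satisfies [phi_m v <= 0] for every [m] with primitive linear part. *)
Definition mults_ok f (v1 v2 : int) := forall p q c, unimodular p q -> has_mult f p q c ->
  p * v1 + q * v2 + c <= 0.

End Mut.

(** * Classes stable under mutation, minimal width, and the triangle case *)

Record mutation_class (V : zmodType) (K : (int -> int -> V) -> Prop) : Prop := MutationClass {
  mc_fin : forall f, K f -> finite_supp f;
  mc_neq0 : forall f, K f -> exists x y, f x y != 0;
  mc_aff : forall f (a b c d e e' : int), K f ->
    a * d - b * c = 1 \/ a * d - b * c = -1 -> K (aff a b c d e e' f);
  mc_mut : forall f g (p q c a b : int), K f -> finite_supp g -> unimodular a b -> p * a + q * b = 0 ->
    (p != 0) || (q != 0) -> mutation_rel f g p q c a b -> K g }.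

(* As [K] is stable under [GL_2(Z)], bounding the extent in [x] bounds all lattice widths. *)
Definition min_width (V : zmodType) (K : (int -> int -> V) -> Prop) (w : int) :=
  forall f, K f -> exists x1 y1 x2 y2, f x1 y1 != 0 /\ f x2 y2 != 0 /\ w <= x1 - x2.

Section Core.
Variable V : zmodType.
Implicit Types f g F : int -> int -> V.
Variable K : (int -> int -> V) -> Prop.
Hypothesis MC : mutation_class K.
Let Kfin := mc_fin MC.
Let Kaff := mc_aff MC.
Let Kmut := mc_mut MC.

Lemma unimodular_neq0 p q : unimodular p q -> (p != 0) || (q != 0).
Proof. by case=> u [v e]; apply/negPn/negP; rewrite negb_or !negbK => /andP [/eqP h1 /eqP h2]; move: e; rewrite h1 h2 !mulr0. Qed.

Lemma int_mul1 (v q : int) : v * q = 1 -> q = 1 \/ q = -1.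
Proof.
move=> /(congr1 absz); rewrite abszM => /eqP; rewrite muln_eq1 => /andP [_ /eqP]; lia.
Qed.

Lemma has_mult_aff_eq f F (p q k p' q' k' a b c d e e' : int) :
  has_mult f p q k -> (forall x y, F x y = f (a * x + b * y + e) (c * x + d * y + e')) ->
  a * d - b * c = 1 \/ a * d - b * c = -1 ->
  p' = p * a + q * c -> q' = p * b + q * d -> k' = k + p * e + q * e' -> has_mult F p' q' k'.
Proof.
move=> H E D -> -> ->.
have -> : F = aff a b c d e e' f by apply/funext => x; apply/funext => y; exact: E.
exact: has_mult_aff.
Qed.

Lemma class_aff_eq f F (a b c d e e' : int) :
  K f -> (forall x y, F x y = f (a * x + b * y + e) (c * x + d * y + e')) ->
  a * d - b * c = 1 \/ a * d - b * c = -1 -> K F.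
Proof.
move=> H E D.
have -> : F = aff a b c d e e' f by apply/funext => x; apply/funext => y; exact: E.
exact: Kaff.
Qed.

Lemma class_mutate f p q c : K f -> unimodular p q -> has_mult f p q c ->
  exists g, K g /\ mutation_rel f g p q c q (- p).
Proof.
move=> Kf pq L.
have [|g hg R] := @has_mult_mutation_rel _ f p q c q (-p) (Kfin Kf) _ L; first by ring.
exists g; split => //; apply: (Kmut Kf hg _ _ _ R); [|by ring|exact: unimodular_neq0].
case: pq => u [v e]; exists v, (- u); rewrite -e; ring.
Qed.

Lemma unimodular_perp p q : unimodular p q -> (q != 0) || (- p != 0).
Proof. by move/unimodular_neq0; rewrite oppr_eq0 orbC. Qed.

Lemma mutation_rel_supp_perp f g p q c x y : K g -> unimodular p q -> mutation_rel f g p q c q (- p) -> g x y != 0 ->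
  (exists s : nat, f (x - q * s%:Z) (y + p * s%:Z) != 0) /\
  (exists s : int, p * x + q * y + c <= s /\ f (x + q * s) (y - p * s) != 0).
Proof.
move=> Kg pq R h.
have [|[s hs] [t [ht hts]]] := mutation_rel_supp (Kfin Kg) (unimodular_perp pq) _ R h; first by ring.
split; [exists s|exists t; split => //].
  by rewrite mulNr opprK in hs.
by rewrite mulNr in hts.
Qed.

Lemma has_mult_row f p q c x y : unimodular p q -> has_mult f p q c -> f x y != 0 -> 0 < p * x + q * y + c ->
  exists t1 t2 : int, f (x + q * t1) (y - p * t1) != 0 /\ f (x + q * t2) (y - p * t2) != 0 /\
    t1 <= t2 /\ p * x + q * y + c <= t2 - t1.
Proof.
move=> pq L h h0.
have [|t1 [t2 H]] := has_mult_dir_row (unimodular_perp pq) _ L h h0; first by ring.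
by exists t1, t2; rewrite !mulNr in H.
Qed.

Variable w : int.
Hypothesis W : min_width K w.

Lemma width_shear f (k : int) : K f -> exists x1 y1 x2 y2,
  f x1 y1 != 0 /\ f x2 y2 != 0 /\ w <= (x1 + k * y1) - (x2 + k * y2).
Proof.
move=> Kf.
have : K (fun x y => f (x - k * y) y).
  apply: (@class_aff_eq f _ 1 (-k) 0 1 0 0 Kf) => [x y|]; first by congr f; ring.
  by left; ring.
case/W => x1 [y1 [x2 [y2 [h1 [h2 h3]]]]].
by exists (x1 - k * y1), y1, (x2 - k * y2), y2; do 2 split => //; rewrite !subrK.
Qed.

Lemma width_y f : K f -> exists x1 y1 x2 y2,
  f x1 y1 != 0 /\ f x2 y2 != 0 /\ w <= y1 - y2.
Proof.
move=> Kf.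
have : K (fun x y => f y x).
  apply: (@class_aff_eq f _ 0 1 1 0 0 0 Kf) => [x y|]; first by congr f; ring.
  by right.
case/W => x1 [y1 [x2 [y2 [h1 [h2 h3]]]]].
by exists y1, x1, y2, x2.
Qed.

(** The mutation at the top retracts the right end of each row by [y + h], and the result still has
    extent [w] along [x + k y]. *)
Lemma mutated_extent f (h k : int) : K f -> has_mult f 0 1 h -> exists x1 y1 x2 y2,
  f x1 y1 != 0 /\ f x2 y2 != 0 /\ w <= (x1 + k * y1 - (y1 + h)) - (x2 + k * y2).
Proof.
move=> Kf L.
have p01 : unimodular 0 1 by exists 0, 1.
have [g [Kg R]] := class_mutate Kf p01 L.
have [x1 [y1 [x2 [y2 [h1 [h2 h3]]]]]] := width_shear k Kg.
have [_ [s [hs fs]]] := mutation_rel_supp_perp Kg p01 R h1.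
have [[t ft] _] := mutation_rel_supp_perp Kg p01 R h2.
move: fs ft; rewrite !mul0r subr0 addr0 !mul1r => fs ft.
exists (x1 + s), y1, (x2 - t%:Z), y2; split => //; split => //.
lia.
Qed.

Lemma mutated_extent_strip f (h : int) : K f -> (forall x y, f x y != 0 -> 0 <= x) -> has_mult f 0 1 h -> exists x y,
  f x y != 0 /\ w <= x - (y + h).
Proof.
move=> Kf Sf L.
have [x1 [y1 [x2 [y2 [h1 [h2 h3]]]]]] := mutated_extent 0 Kf L.
exists x1, y1; split => //; have := Sf _ _ h2; lia.
Qed.

Definition in_triangle (d : int) f := forall x y, f x y != 0 -> 0 <= x /\ 0 <= y /\ x + y <= d.

(** The mutation along the bottom pushes the left side onto [x + y = c], leaving extent at most
    [w + k - c] along [x + y]. *)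
Lemma triangle_side_mult f (k c : int) : K f -> in_triangle (w + k) f -> has_mult f 0 (-1) c -> c <= k.
Proof.
move=> Kf T L.
have p01 : unimodular 0 (-1) by exists 0, (-1).
have [g [Kg R]] := class_mutate Kf p01 L.
have [x1 [y1 [x2 [y2 [h1 [h2 h3]]]]]] := width_shear 1 Kg.
have [[t /T ft] _] := mutation_rel_supp_perp Kg p01 R h1.
have [_ [s [hs /T fs]]] := mutation_rel_supp_perp Kg p01 R h2.
lia.
Qed.

Lemma mul_ge_l (a b : int) : 1 <= a -> 0 <= b -> b <= a * b.
Proof. by move=> h1 h2; rewrite ler_peMl. Qed.

Lemma mul_le_bound (a t b : int) : 1 <= a -> a * t <= b -> 0 <= b -> t <= b.
Proof.
move=> h1 h2 h3; case: (leP t 0) => ht; first by lia.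
by apply: le_trans h2; apply: mul_ge_l => //; lia.
Qed.

(** For oblique normals, minimal width along [x + y] gives a support point with [xa + ya <= k]. The
    axes cut its row to length at most [xa + ya], while a violated constraint would force length
    above [v1 + v2 - xa - ya >= k]. *)
Lemma triangle_corner_ok f (k v1 v2 p q c : int) : K f -> in_triangle (w + k) f -> k <= v1 -> k <= v2 ->
  p <= 0 -> q <= 0 -> unimodular p q -> has_mult f p q c -> p * v1 + q * v2 + c <= 0.
Proof.
move=> Kf T kv1 kv2 p0 q0 pq L.
case: (eqVneq p 0) => [e|pn0].
  have q1 : q = -1.
    by case: pq => u [v]; rewrite e mulr0 add0r => /int_mul1; lia.
  by move: L; rewrite e q1 => /(triangle_side_mult Kf T); lia.
case: (eqVneq q 0) => [e|qn0].
  have p1 : p = -1.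
    by case: pq => u [v]; rewrite e mulr0 addr0 => /int_mul1; lia.
  have K' : K (fun x y => f y x).
    apply: (@class_aff_eq f _ 0 1 1 0 0 0 Kf) => [x y|]; first by congr f; ring.
    by right.
  have L' : has_mult (fun x y => f y x) 0 (-1) c.
    move: L; rewrite p1 e => L.
    apply: (@has_mult_aff_eq f _ (-1) 0 c _ _ _ 0 1 1 0 0 0 L) => [x y||||]; try ring.
      by congr f; ring.
    by right.
  have T' : in_triangle (w + k) (fun x y => f y x) by move=> x y /T; lia.
  have := triangle_side_mult K' T' L'; rewrite p1 e; lia.
have P1 : 1 <= - p by lia.
have Q1 : 1 <= - q by lia.
have [x1 [y1 [xa [ya [/T h1 [hA h3]]]]]] := width_shear 1 Kf.
have hAk : xa + ya <= k by lia.
have [TA1 [TA2 TA3]] := T _ _ hA.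
rewrite leNgt; apply/negP => hv.
have hP : v1 - xa <= - p * (v1 - xa) by apply: mul_ge_l => //; lia.
have hQ : v2 - ya <= - q * (v2 - ya) by apply: mul_ge_l => //; lia.
have hi : 1 + (v1 - xa) + (v2 - ya) <= p * xa + q * ya + c.
  have -> : p * xa + q * ya + c = (p * v1 + q * v2 + c) + - p * (v1 - xa) + - q * (v2 - ya) by ring.
  lia.
have hi' : 0 < p * xa + q * ya + c by lia.
have [t1 [t2 [f1 [f2 [_ t12]]]]] := has_mult_row pq L hA hi'.
have [_ [g1 _]] := T _ _ f1; have [g2 _] := T _ _ f2.
have b1 : - t1 <= ya.
  by apply: (@mul_le_bound (- p)) => //; rewrite mulrNN; lia.
have b2 : t2 <= xa.
  by apply: (@mul_le_bound (- q)) => //; rewrite mulNr; lia.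
lia.
Qed.

(** An affine symmetry of order three permutes the corners and carries every normal to one with
    nonpositive entries. The distances of the point to the sides are [k], [k] and [w - k >= k]. *)
Lemma triangle_ok f (k : int) : K f -> in_triangle (w + k) f -> 2 * k <= w -> mults_ok f k k.
Proof.
move=> Kf T kw.
pose d := w + k.
have main F (v1 v2 p q c : int) : K F -> in_triangle d F -> k <= v1 -> k <= v2 ->
  p <= 0 -> q <= 0 -> unimodular p q -> has_mult F p q c -> p * v1 + q * v2 + c <= 0.
  exact: triangle_corner_ok.
have rotK F : K F -> K (fun x y => F (d - x - y) x).
  move=> KF'; apply: (@class_aff_eq F _ (-1) (-1) 1 0 d 0 KF') => [x y|]; first by congr F; ring.
  by left.
have rotT F : in_triangle d F -> in_triangle d (fun x y => F (d - x - y) x).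
  by move=> TF x y /TF; lia.
have rotL F p q c : has_mult F p q c -> has_mult (fun x y => F (d - x - y) x) (q - p) (- p) (c + p * d).
  move=> L; apply: (@has_mult_aff_eq F _ p q c _ _ _ (-1) (-1) 1 0 d 0 L) => [x y||||]; try ring.
    by congr F; ring.
  by left.
have rotP p q : unimodular p q -> unimodular (q - p) (- p).
  by case=> u [v e]; exists v, (- u - v); rewrite -e; ring.
move=> p q c pq L.
case: (boolP ((p <= 0) && (q <= 0))) => [/andP [p0 q0]|n1]; first by apply: main L.
case: (boolP ((q - p <= 0) && (- p <= 0))) => [/andP [p0 q0]|n2].
  have := main _ k (d - k - k) _ _ _ (rotK _ Kf) (rotT _ T) (lexx k) ltac:(lia) p0 q0 (rotP _ _ pq) (rotL _ _ _ _ L).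
  by congr (_ <= 0); rewrite /d; ring.
have := main _ (d - k - k) k _ _ _ (rotK _ (rotK _ Kf)) (rotT _ (rotT _ T)) ltac:(lia) (lexx k) _ _
  (rotP _ _ (rotP _ _ pq)) (rotL _ _ _ _ (rotL _ _ _ _ L)).
move=> /(_ ltac:(lia) ltac:(lia)).
by congr (_ <= 0); rewrite /d; ring.
Qed.

End Core.

(** * Multiplicity at the top edge as a power of an ideal *)

Section Persist.
Variable V : zmodType.
Implicit Types f g F G H : int -> int -> V.

(* Membership in the [h]-th power of the ideal [(1 + X, T)] with [T = Y^-1], on
   arrays supported in [0 <= x], [y <= 0]: the local form of multiplicity [h] at a
   point of the top edge, stable under changes of variables fixing the ideal. *)
Fixpoint point_ideal (h : nat) F : Prop :=
  if h is k.+1 then exists G H, [/\ point_ideal k G, point_ideal k H & F = fun x y => mulp 1 0 G x y + H x (y + 1)]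
  else finite_supp F /\ forall x y, F x y != 0 -> 0 <= x /\ y <= 0.

Lemma point_ideal_supp h F : point_ideal h F -> point_ideal 0 F.
Proof.
elim: h F => // h IH F [G [H [/IH [fG sG] /IH [fH sH] ->]]]; split.
  apply: fin_add; first exact: mulp_fin.
  by case: fH => B hB; exists (`|B| + 1) => x y /hB; lia.
move=> x y /addV_neq0 [/addV_neq0 [/sG|/sG]|/sH]; lia.
Qed.

Lemma point_ideal_add h F G : point_ideal h F -> point_ideal h G -> point_ideal h (fun x y => F x y + G x y).
Proof.
elim: h F G => [|h IH] F G.
  move=> [fF sF] [fG sG]; split; first exact: fin_add.
  by move=> x y /addV_neq0 [/sF|/sG].
move=> [F1 [F2 [h1 h2 ->]]] [G1 [G2 [h3 h4 ->]]].
exists (fun x y => F1 x y + G1 x y), (fun x y => F2 x y + G2 x y); split; try exact: IH.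
by rewrite mulp_add; apply/funext => x; apply/funext => y; rewrite addrACA.
Qed.

Lemma point_ideal_opp h F : point_ideal h F -> point_ideal h (fun x y => - F x y).
Proof.
elim: h F => [|h IH] F.
  move=> [[B hB] sF]; split; last by move=> x y; rewrite oppr_eq0 => /sF.
  by exists B => x y; rewrite oppr_eq0 => /hB.
move=> [F1 [F2 [h1 h2 ->]]].
exists (fun x y => - F1 x y), (fun x y => - F2 x y); split; try exact: IH.
by apply/funext => x; apply/funext => y; rewrite /mulp !opprD.
Qed.

Lemma point_ideal_zero h : point_ideal h (fun _ _ => 0).
Proof.
elim: h => [|h IH].
  by split; [exists 0|] => x y; rewrite eqxx.
exists (fun _ _ => 0), (fun _ _ => 0); split => //.
by apply/funext => x; apply/funext => y; rewrite /mulp !addr0.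
Qed.

Lemma point_ideal_mono h F : point_ideal h.+1 F -> point_ideal h F.
Proof.
elim: h F => [|h IH] F; first exact: point_ideal_supp.
by move=> [G [H [/IH hG /IH hH ->]]]; exists G, H.
Qed.

Lemma point_ideal_shift_y h F : point_ideal h F -> point_ideal h.+1 (fun x y => F x (y + 1)).
Proof.
move=> hF; exists (fun _ _ => 0), F; split => //; first exact: point_ideal_zero.
by apply/funext => x; apply/funext => y; rewrite /mulp addr0 add0r.
Qed.

Lemma point_ideal_mulp h F : point_ideal h F -> point_ideal h.+1 (mulp 1 0 F).
Proof.
move=> hF; exists F, (fun _ _ => 0); split => //; first exact: point_ideal_zero.
by apply/funext => x; apply/funext => y; rewrite addr0.
Qed.

Lemma point_ideal_shift_x h F : point_ideal h F -> point_ideal h (fun x y => F (x - 1) y).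
Proof.
elim: h F => [|h IH] F.
  move=> [[B hB] sF]; split; last by move=> x y /sF; lia.
  by exists (`|B| + 1) => x y /hB; lia.
move=> [G [H [/IH hG /IH hH ->]]].
by exists (fun x y => G (x - 1) y), (fun x y => H (x - 1) y).
Qed.

(** [1 + T] is a unit modulo each power of the ideal: [G = (1 + T) G - T G], and [T G] gains one
    order over [G]. *)
Lemma point_ideal_unit_inv h G : point_ideal 0 G -> point_ideal h (mulp 0 (-1) G) -> point_ideal h G.
Proof.
move=> G0; elim: h => // h IH hD.
have hG : point_ideal h G by apply/IH/point_ideal_mono.
have -> : G = fun x y => mulp 0 (-1) G x y + - G x (y + 1).
  by apply/funext => x; apply/funext => y; rewrite /mulp subr0 opprK addrK.
by apply: point_ideal_add => //; apply: point_ideal_opp; apply: point_ideal_shift_y.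
Qed.

(* The substitution [X := X (1 + T)]. *)
Definition twist F : int -> int -> V := fun x y => mulpn 0 (-1) (absz x) F x y.

Lemma twist_fin F : finite_supp F -> finite_supp (twist F).
Proof.
move=> hF; apply: (@fin_patch _ F _ 1 0 0 0 (-1)) => // x y /mulpn_supp [j hj h].
by exists j%:Z; split => //; lia.
Qed.

(** The generator [1 + X] goes to [(1 + X) + X T], again in the ideal. *)
Lemma point_ideal_twist h F : point_ideal h F -> point_ideal h (twist F).
Proof.
elim: h F => [|h IH] F.
  move=> [fF sF]; split; first exact: twist_fin.
  by move=> x y /mulpn_supp [j _ /sF]; lia.
move=> [G [H [hG hH ->]]].
have [_ sG] := point_ideal_supp hG.
have -> : twist (fun x y => mulp 1 0 G x y + H x (y + 1)) =
  fun x y => mulp 1 0 (twist G) x y + (twist G (x - 1) (y + 1) + twist H x (y + 1)).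
  apply/funext => x; apply/funext => y; rewrite /twist mulpn_add addrA; congr (_ + _); last first.
    have tr k : mulpn 0 (-1) k (fun x y => H x (y + 1)) x y = mulpn 0 (-1) k H x (y + 1).
      elim: k (y) => // k IHk z; by rewrite !mulpnS !subr0 !IHk addrAC.
    exact: tr.
  rewrite (mulpnC 0 (-1) 1 0 (absz x) 1 G : mulpn _ _ _ (mulp 1 0 G) = mulp 1 0 (mulpn _ _ _ G)).
  rewrite !mulpE subr0 -addrA; congr (_ + _).
  have [hx|hx] := ltP 0 x.
    have -> : absz x = (absz (x - 1)).+1 by lia.
    by rewrite mulpnS !subr0 opprK.
  (* [absz] is not additive across [x = 0], but there the shifted column lies left of the
     support. *)
  rewrite !mulpn_eq0 ?addr0 // => j _; apply/eqP/negPn/negP => /sG; lia.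
exists (twist G), (fun x y => twist G (x - 1) y + twist H x y); split => //; first exact: IH.
by apply: point_ideal_add; [apply: (point_ideal_shift_x (IH _ hG))|apply: IH].
Qed.

Lemma point_ideal_has_mult h F : point_ideal h F -> has_mult F 0 1 h%:Z.
Proof.
suff main : point_ideal h F -> exists2 g, finite_supp g & forall x y (i : nat), y + h%:Z = i.+1%:Z -> F x y = mulpn 1 0 i.+1 g x y.
  move/main => [g hg H]; exists g => // x y i; rewrite mul0r mul1r add0r; exact: H.
elim: h F => [|h IH] F.
  move=> [fF sF]; exists (fun _ _ => 0); first by exists 0 => x y; rewrite eqxx.
  move=> x y i e; rewrite mulpn_eq0 //; apply/eqP/negPn/negP => /sF; lia.
move=> [G [H [hG hH ->]]].
have [fG sG] := point_ideal_supp hG.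
have [g1 f1 H1] := IH _ hG; have [g2 f2 H2] := IH _ hH.
(* In the row [y = -h] a single factor [1 + X] is required, so [G] itself is the quotient there. *)
exists (fun x y => (if y + h%:Z == 0 then G x y else g1 x y) + g2 x (y + 1)).
  apply: fin_add; last by case: f2 => B hB; exists (`|B| + 1) => x y /hB; lia.
  case: fG => B hB; case: f1 => C hC; exists (`|B| + `|C|) => x y.
  by case: ifP => _; [move/hB|move/hC]; lia.
move=> x y i e; rewrite mulpn_add; congr (_ + _); last first.
  rewrite (H2 _ _ i); last by lia.
  elim: i.+1 (x) => // k IHk z; by rewrite !mulpnS !subr0 !IHk.
rewrite mulpnS mulpE !subr0.
have E z : G z y = mulpn 1 0 i (fun x0 y0 => if y0 + h%:Z == 0 then G x0 y0 else g1 x0 y0) z y.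
  case: i e => [|i] e.
    by rewrite /mulpn /=; case: eqP => //; lia.
  rewrite (H1 _ _ i); last by lia.
  by apply: mulpn_ext => j _; rewrite mul0r subr0; case: eqP => //; lia.
by rewrite !E.
Qed.

(** Peel off the top row, a multiple of [(1 + X)^h]; what remains is [T] times an array of
    multiplicity [h - 1]. *)
Lemma has_mult_point_ideal h F : point_ideal 0 F -> has_mult F 0 1 h%:Z -> point_ideal h F.
Proof.
move=> F0 [g hg H].
have {}H (x y : int) (i : nat) : y <= 0 -> y + h%:Z = i.+1%:Z -> F x y = mulpn 1 0 i.+1 g x y.
  by move=> _ e; apply: H; lia.
elim: h F F0 g hg H => [|h IH] F F0 g hg H //.
have [fF sF] := F0.
pose G (x y : int) : V := if y == 0 then g x 0 else 0.
pose F1 (x y : int) : V := if y <= 0 then F x (y - 1) else 0.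
have E0 : forall x y : int, mulpn 1 0 h.+1 G x y = if y == 0 then F x 0 else 0.
  move=> x y; case: eqP => [->|ny].
    rewrite (H _ _ h (lexx 0) (add0r _)).
    by apply: mulpn_ext => j _; rewrite mul0r subr0 /G.
  by apply: mulpn_eq0 => j _; rewrite mul0r subr0 /G; case: eqP.
have G0 : point_ideal 0 G.
  split.
    by case: hg => B hB; exists `|B| => x y; rewrite /G; case: (eqVneq y 0) => [->|_]; [move/hB; lia|rewrite eqxx].
  move=> x y; rewrite /G; case: (eqVneq y 0) => [->|_]; last by rewrite eqxx.
  move=> gx; have [s] := @mulpn_left _ 1 0 h.+1 g x 0 isT hg gx.
  rewrite -(H _ _ h (lexx 0) (add0r _)).
  by move/sF; lia.
have F10 : point_ideal 0 F1.
  split; last by move=> x y; rewrite /F1; case: ifP => [h1 /sF|]; [lia|rewrite eqxx].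
  case: fF => B hB; exists (`|B| + 1) => x y; rewrite /F1; case: ifP => [_ /hB|]; first by lia.
  by rewrite eqxx.
exists (mulpn 1 0 h G), F1; split.
- by elim: (h) => // k IHk; apply: point_ideal_mulp.
- apply: (IH F1 F10 (fun x y => g x (y - 1))).
    by case: hg => B hB; exists (`|B| + 1) => x y /hB; lia.
  move=> x y i y0 e; rewrite /F1 y0 (H _ _ i); [|lia|lia].
  elim: i.+1 (x) => // k IHk z; by rewrite !mulpnS !subr0 !IHk.
apply/funext => x; apply/funext => y.
rewrite -[mulp 1 0 (mulpn 1 0 h G)]/(mulpn 1 0 h.+1 G) E0 /F1.
case: eqP => [->|ny]; first by rewrite /= addr0.
case: ifP => h1; first by rewrite add0r addrK.
rewrite add0r; apply/eqP/negPn/negP => /sF; lia.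
Qed.

(* Mutating along the left edge does not change multiplicities on the top edge:
   the mutation is [twist] followed by division by the unit [(1 + T)^b]. *)
Lemma has_mult_persist (h b : nat) F F' : point_ideal 0 F -> point_ideal 0 F' -> mutation_rel F F' (-1) 0 b%:Z 0 (-1) ->
  has_mult F 0 1 h%:Z -> has_mult F' 0 1 h%:Z.
Proof.
move=> F0 F0' R /(has_mult_point_ideal F0) /point_ideal_twist.
have [fF sF] := F0; have [fF' sF'] := F0'.
(* Both sides agree column by column: for [x <= b] the mutation reads [F = (1 + T)^(b - x) F'], for
   [x >= b] it reads [F' = (1 + T)^(x - b) F]. *)
have -> : twist F = mulpn 0 (-1) b F'.
  apply/funext => x; apply/funext => y; rewrite /twist.
  have [x0|x0] := leP 0 x; last first.
    rewrite !mulpn_eq0 // => j _; apply/eqP/negPn/negP; [move/sF'|move/sF]; lia.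
  have [xb|xb] := leP x b%:Z.
    have -> : b = (absz x + absz (b%:Z - x))%N by lia.
    rewrite mulpnD; apply: mulpn_ext => j _; apply R; lia.
  have -> : absz x = (b + absz (x - b%:Z))%N by lia.
  rewrite mulpnD; apply: mulpn_ext => j _; apply/esym; apply R; lia.
move=> hI; apply: point_ideal_has_mult.
elim: b {R} hI => // b IH hI; apply: IH; apply: point_ideal_unit_inv => //.
split; first exact: mulpn_fin.
by move=> x y /mulpn_supp [j _ /sF']; lia.
Qed.

End Persist.

Lemma max_nat (P : nat -> Prop) (m : nat) : P 0%N -> (forall i, P i -> (i <= m)%N) ->
  exists i, P i /\ forall j, P j -> (j <= i)%N.
Proof.
move=> P0 Pm.
have ex : exists i, `[< P i >] by exists 0%N; apply/asboolP.
have bd : forall i, `[< P i >] -> (i <= m)%N by move=> i /asboolP /Pm.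
case: (ex_maxnP ex bd) => i /asboolP Pi H; exists i; split => // j Pj.
by apply: H; apply/asboolP.
Qed.

Lemma min_nat (P : nat -> Prop) : (exists i, P i) -> exists i, P i /\ forall j, P j -> (i <= j)%N.
Proof.
move=> [i0 P0].
have ex : exists i, `[< P i >] by exists i0; apply/asboolP.
case: (ex_minnP ex) => i /asboolP Pi H; exists i; split => // j Pj.
by apply: H; apply/asboolP.
Qed.

(** * Constraints from above and from below *)

Section Charts.
Variable V : zmodType.
Implicit Types f g F G : int -> int -> V.

(** Exchanges the top line [y = 0] with the bottom line [y = s x - g], so statements about the top
    also serve the bottom. *)
Definition flip (s g : int) f : int -> int -> V := fun x y => f x (s * x - g - y).

Lemma flipK (s g : int) f : flip s g (flip s g f) = f.
Proof. by apply/funext => x; apply/funext => y; rewrite /flip; congr f; ring. Qed.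

Lemma has_mult_flip (s g : int) f (p q c : int) : has_mult f p q c ->
  has_mult (flip s g f) (p + q * s) (- q) (c - q * g).
Proof.
move=> L; apply: (@has_mult_aff_eq V f _ p q c _ _ _ 1 0 s (-1) 0 (- g) L) => [x y||||]; try ring.
  by rewrite /flip; congr f; ring.
by right; ring.
Qed.

Lemma has_mult_nonpos f p q c : (forall x y, f x y != 0 -> p * x + q * y + c <= 0) -> has_mult f p q c.
Proof.
move=> S; exists (fun _ _ => 0); first by exists 0 => x y; rewrite eqxx.
move=> x y i e; rewrite mulpn_eq0 //; apply/eqP/negPn/negP => /S; lia.
Qed.

Definition upper_ok f (x r : int) := forall p q c : int, 0 < q -> unimodular p q -> has_mult f p q c ->
  p * x - q * r + c <= 0.

(* A support point near each end of the top boundary controls all upper constraints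
   except the one with normal [(0, 1)]: a row through it is too short to be
   divisible by a high power. *)
Lemma upper_ok_corners f (w x r xa ya xb yb : int) :
  (forall x y, f x y != 0 -> 0 <= x /\ x <= w /\ y <= 0) ->
  f xa ya != 0 -> - ya <= x - xa -> xa - ya <= r ->
  f xb yb != 0 -> - yb <= xb - x -> (w - xb) - yb <= r ->
  (forall c, has_mult f 0 1 c -> c <= r) -> upper_ok f x r.
Proof.
move=> S fa a1 a2 fb b1 b2 H p q c q0 pq L.
have [Sa1 [Sa2 Sa3]] := S _ _ fa; have [Sb1 [Sb2 Sb3]] := S _ _ fb.
have [e|] := eqVneq p 0.
  have q1 : q = 1.
    by case: pq => u [v]; rewrite e mulr0 add0r => /int_mul1; lia.
  by move: L; rewrite e q1 => /H; lia.
rewrite neq_lt => /orP [pn|pp].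
  set i := p * xa + q * ya + c.
  have E : p * x - q * r + c = i - (- p) * (x - xa) - q * (r + ya) by rewrite /i; ring.
  have h1 : x - xa <= - p * (x - xa) by apply: mul_ge_l; lia.
  have h2 : r + ya <= q * (r + ya) by apply: mul_ge_l; lia.
  rewrite E; have [i0|i0] := leP i 0; first by clear -i0 h1 h2 a1 a2 Sa3 Sa1; lia.
  have [t1 [t2 [f1 [f2 [_ t12]]]]] := has_mult_row pq L fa i0.
  have [g1 _] := S _ _ f1; have [_ [_ g2]] := S _ _ f2.
  have c1 : - t1 <= xa.
    by apply: (@mul_le_bound q); rewrite ?mulrN ?mulNr; lia.
  have c2 : t2 <= - ya.
    by apply: (@mul_le_bound (- p)); rewrite ?mulrN ?mulNr; lia.
  rewrite -/i in t12; clear -t12 c1 c2 h1 h2 a1 a2; lia.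
set i := p * xb + q * yb + c.
have E : p * x - q * r + c = i - p * (xb - x) - q * (r + yb) by rewrite /i; ring.
have h1 : xb - x <= p * (xb - x) by apply: mul_ge_l; lia.
have h2 : r + yb <= q * (r + yb) by apply: mul_ge_l; lia.
rewrite E; have [i0|i0] := leP i 0; first by clear -i0 h1 h2 b1 b2 Sb3 Sb2; lia.
have [t1 [t2 [f1 [f2 [_ t12]]]]] := has_mult_row pq L fb i0.
have [_ [g2 _]] := S _ _ f2; have [_ [_ g1]] := S _ _ f1.
have c1 : - t1 <= - yb.
  by apply: (@mul_le_bound p); rewrite ?mulrN ?mulNr; lia.
have c2 : t2 <= w - xb.
  by apply: (@mul_le_bound q); rewrite ?mulrN ?mulNr; lia.
rewrite -/i in t12; clear -t12 c1 c2 h1 h2 b1 b2; lia.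
Qed.

Lemma mults_ok_of_upper f (s g x r : int) : upper_ok f x r -> upper_ok (flip s g f) x (g - s * x - r) ->
  (forall c, has_mult f (-1) 0 c -> c <= x) -> (forall c, has_mult f 1 0 c -> x + c <= 0) -> mults_ok f x (- r).
Proof.
move=> U D Lf Rt p q c pq L.
case: (ltrgtP q 0) => q0.
- have := D _ _ _ _ _ (has_mult_flip s g L).
  have pq' : unimodular (p + q * s) (- q) by case: pq => u [v e]; exists u, (u * s - v); rewrite -e; ring.
  move=> /(_ ltac:(lia) pq'); congr (_ <= 0); ring.
- by have := U _ _ _ q0 pq L; congr (_ <= 0); ring.
have : p = 1 \/ p = -1 by case: pq => u [v]; rewrite q0 mulr0 addr0 => /int_mul1.
by case=> e; move: L; rewrite q0 e; [move/Rt|move/Lf]; lia.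
Qed.

(** The nonzero top row is at least as long as any multiplicity, which bounds the multiplicities by
    [w] and makes a maximum exist. *)
Lemma top_mult f (w xt : int) : (forall x y, f x y != 0 -> 0 <= x /\ x <= w /\ y <= 0) ->
  f xt 0 != 0 -> exists h : nat, [/\ has_mult f 0 1 h%:Z, (forall c, has_mult f 0 1 c -> c <= h%:Z), h%:Z <= w &
    exists a b : int, [/\ f a 0 != 0, f b 0 != 0 & h%:Z <= b - a]].
Proof.
move=> S ft.
have p01 : unimodular 0 1 by exists 0, 1.
have row (h : nat) : has_mult f 0 1 h%:Z -> exists a b : int, [/\ f a 0 != 0, f b 0 != 0 & h%:Z <= b - a].
  move=> L; case: h L => [|h] L; first by exists xt, xt; split => //; lia.
  have [|t1 [t2 [f1 [f2 [_ t12]]]]] := has_mult_row p01 L ft; first by lia.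
  exists (xt + t1), (xt + t2); move: f1 f2; rewrite !mul1r !mul0r subr0 => f1 f2.
  by split => //; lia.
have bd (h : nat) : has_mult f 0 1 h%:Z -> h%:Z <= w.
  by move/row => [a [b [/S ha /S hb hh]]]; lia.
have [|i|h [hh hmax]] := @max_nat (fun h => has_mult f 0 1 h%:Z) (absz w).
- by apply: has_mult_nonpos => x y /S; lia.
- by move/bd; lia.
exists h; split => //; [|exact: bd|exact: row].
move=> c; have [c0|c0] := leP c 0; first by lia.
have -> : c = (absz c)%:Z by lia.
by move/hmax; lia.
Qed.

End Charts.

(** * Division by a binomial against minimal width *)

Section Core2.
Variable V : zmodType.
Implicit Types f g F G : int -> int -> V.
Variable K : (int -> int -> V) -> Prop.
Hypothesis MC : mutation_class K.
Let Kfin := mc_fin MC.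

(* Dividing by [1 + z^(a,b)] is a mutation at [(p, q, c)] followed by one at
   [(-p, -q, 1 - c)]. *)
Lemma class_div f g (p q a b : int) : K f -> finite_supp g -> unimodular a b -> p * a + q * b = 0 ->
  (p != 0) || (q != 0) -> (forall x y, f x y = mulp a b g x y) -> K g.
Proof.
move=> Kf hg ab pab pq E.
have [B hB] := Kfin Kf; have [C hC] := hg.
(* So negative that both supports lie in height at most [0], where the first mutation only
   multiplies. *)
pose c := - ((`|p| + `|q|) * (`|B| + `|C|)).
have row (j : nat) x y : p * (x - a * j%:Z) + q * (y - b * j%:Z) = p * x + q * y.
  have -> : p * (x - a * j%:Z) + q * (y - b * j%:Z) = p * x + q * y - (p * a + q * b) * j%:Z by ring.
  by rewrite pab mul0r subr0.
have cb x y : `|x| <= `|B| + `|C| -> `|y| <= `|B| + `|C| -> p * x + q * y + c <= 0.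
  move=> hx hy; rewrite /c subr_le0; apply: le_trans (ler_norm _) _.
  apply: le_trans (ler_normD _ _) _; rewrite !normrM mulrDl.
  by apply: lerD; rewrite ler_wpM2l.
have f0 x y : 0 < p * x + q * y + c -> f x y = 0.
  move=> h; apply/eqP/negPn/negP => /hB hh.
  have := cb x y ltac:(clear -hh; lia) ltac:(clear -hh; lia); rewrite leNgt h.
  done.
have g0 x y : 0 < p * x + q * y + c -> g x y = 0.
  move=> h; apply/eqP/negPn/negP => /hC hh.
  have := cb x y ltac:(clear -hh; lia) ltac:(clear -hh; lia); rewrite leNgt h.
  done.
pose f1 x y := if 0 < p * x + q * y + c then 0 else mulpn a b (absz (p * x + q * y + c)) f x y.
have f10 x y : 0 < p * x + q * y + c -> f1 x y = 0 by rewrite /f1 => ->.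
have K1 : K f1.
  apply: (@mc_mut _ _ MC f f1 p q c a b) => //.
    apply: (@fin_patch _ f f1 p q c a b (Kfin Kf) pab) => x y.
    rewrite /f1; case: ifP => h; first by rewrite eqxx.
    by move/mulpn_supp => [j hj hfj]; exists j%:Z; split => //; lia.
  move=> x y i; split => e.
    case: i e => [|i] e; first by rewrite /mulpn /= /f1 e ltxx.
    rewrite f0 ?e // mulpn_eq0 // => j _; apply: f10; rewrite row e; lia.
  rewrite /f1 e; have -> : 0 < - i%:Z = false by lia.
  by rewrite abszN.
apply: (@mc_mut _ _ MC f1 g (-p) (-q) (1 - c) a b) => //.
- by rewrite !mulNr -opprD pab oppr0.
- by rewrite !oppr_eq0.
move=> x y i; split => e.
  case: i e => [|i] e.
    by rewrite /mulpn /= f10 ?g0 //; lia.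
  have e' : p * x + q * y + c = - i%:Z by lia.
  rewrite /f1 e'; have -> : 0 < - i%:Z = false by lia.
  rewrite abszN absz_nat -[i.+1]addn1 mulpnD; apply: mulpn_ext => j _; exact: E.
rewrite g0; last by lia.
rewrite mulpn_eq0 // => j _; apply: f10; rewrite row; lia.
Qed.

Variable w : int.
Hypothesis W : min_width K w.

Lemma not_div_x f g : K f -> (forall x y, f x y != 0 -> 0 <= x /\ x <= w) -> finite_supp g ->
  (forall x y, f x y = mulp 1 0 g x y) -> False.
Proof.
move=> Kf S hg E.
have p10 : unimodular 1 0 by exists 1, 0.
have Kg : K g by apply: (@class_div f g 0 1 1 0).
have [x1 [y1 [x2 [y2 [h1 [h2 h3]]]]]] := W Kg.
have [s] := @mulp_right _ 1 0 g _ _ isT hg h1; rewrite -E => /S.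
have [t] := @mulp_left _ 1 0 g _ _ isT hg h2; rewrite -E => /S.
lia.
Qed.

(* Otherwise every row is divisible by [1 + X], and dividing lowers the width. *)
Lemma parallel f (gap : int) (h h' : nat) : K f ->
  (forall x y, f x y != 0 -> 0 <= x /\ x <= w /\ - gap <= y /\ y <= 0) ->
  has_mult f 0 1 h%:Z -> has_mult (flip 0 gap f) 0 1 h'%:Z -> h%:Z + h'%:Z <= gap.
Proof.
move=> Kf S [g1 fg1 H1] [g2 fg2 H2]; rewrite leNgt; apply/negP => hh.
(* Rows with [y > -h] take a factor [1 + X] from the top multiplicity, the others from the bottom
   one, positive there because [h + h' > gap]. *)
pose G (x y : int) := if (y <= 0) && (- gap <= y) then
  (if 0 < y + h%:Z then mulpn 1 0 (absz (y + h%:Z)).-1 g1 x y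
   else mulpn 1 0 (absz (h'%:Z + - gap + - y)).-1 g2 x (- gap - y)) else 0.
have fG : finite_supp G.
  case: fg1 => B hB; case: fg2 => C hC; exists (`|B| + `|C| + `|gap| + h%:Z + h'%:Z) => x y.
  rewrite /G; case: ifP => [hy|_]; last by rewrite eqxx.
  by case: ifP => hyh /mulpn_supp [j hj]; [move/hB|move/hC]; clear -hj hy hyh; lia.
apply: (not_div_x Kf _ fG) => x y; first by move/S; lia.
have [hy|hy] := boolP ((y <= 0) && (- gap <= y)); last first.
  rewrite mulpE /G subr0 (negbTE hy) addr0; apply/eqP/negPn/negP => /S; lia.
have eG z : G z y = (if 0 < y + h%:Z then mulpn 1 0 (absz (y + h%:Z)).-1 g1 z y
   else mulpn 1 0 (absz (h'%:Z + - gap + - y)).-1 g2 z (- gap - y)) by rewrite /G hy.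
rewrite mulpE subr0 !eG; case: ifP => hyh.
  rewrite (H1 x y (absz (y + h%:Z)).-1); last by lia.
  by rewrite oppr0 mulpnS subr0.
have -> : f x y = flip 0 gap f x (- gap - y) by rewrite /flip; congr f; ring.
rewrite (H2 x _ (absz (h'%:Z + - gap + - y)).-1); last by lia.
by rewrite oppr0 mulpnS subr0.
Qed.

End Core2.

(** * Mutation along the left edge *)

Section LeftStep.
Variable V : zmodType.
Implicit Types f g F G : int -> int -> V.

Definition not_div_y f := ~ exists2 g, finite_supp g & forall x y, f x y = mulp 0 1 g x y.

Section LeftMut.
Variables (f f' : int -> int -> V) (b : nat).
Hypotheses (ff : finite_supp f) (ff' : finite_supp f').
Hypothesis R : mutation_rel f f' (-1) 0 b%:Z 0 1.
Hypothesis max_b : forall c, has_mult f (-1) 0 c -> c <= b%:Z.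

Let R1 x y (i : nat) : x = b%:Z - i%:Z -> f x y = mulpn 0 1 i f' x y.
Proof. by move=> e; apply R; lia. Qed.

Let R2 x y (i : nat) : x = b%:Z + i%:Z -> f' x y = mulpn 0 1 i f x y.
Proof. by move=> e; apply R; lia. Qed.

(** With [c > b], multiplying the columns [x <= b] back would give [f] left multiplicity [b + 1]. *)
Lemma leftmut_left c : has_mult f' (-1) 0 c -> c <= b%:Z.
Proof.
move=> [g hg H]; rewrite leNgt; apply/negP => cb.
have : has_mult f (-1) 0 (b%:Z + 1); last by move/max_b; lia.
pose G x y := if x <= b%:Z then mulpn 0 1 (absz (c - x)).-1 g x y else 0.
exists G.
  apply: (@fin_patch _ g G (-1) 0 c 0 1) => // x y; rewrite /G; case: ifP; last by rewrite eqxx.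
  by move=> _ /mulpn_supp [j hj hgj]; exists j%:Z; split => //; lia.
move=> x y i e; rewrite opprK (@R1 x y i); last by lia.
have E : forall z, mulpn 0 1 (absz (c - x)) g x z = f' x z.
  move=> z; rewrite (H x z (absz (c - x)).-1); last by lia.
  by rewrite opprK; congr (mulpn _ _ _ _ _ _); lia.
have -> : mulpn 0 1 i f' x y = mulpn 0 1 i (mulpn 0 1 (absz (c - x)) g) x y.
  by apply: mulpn_ext => j _; rewrite mul0r subr0 E.
rewrite -mulpnD; have -> : (i + absz (c - x) = i.+1 + (absz (c - x)).-1)%N by lia.
rewrite mulpnD; apply: mulpn_ext => j _; rewrite mul0r subr0 /G; case: ifP => //; lia.
Qed.

Lemma leftmut_ndiv : not_div_y f'.
Proof.
move=> [g hg E].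
have : has_mult f (-1) 0 (b%:Z + 1); last by move/max_b; lia.
exists g => // x y i e; rewrite opprK (@R1 x y i); last by lia.
rewrite -[i.+1]addn1 mulpnD; apply: mulpn_ext => j _; exact: E.
Qed.

(** With [c > -b] all of [f] would be divisible by [1 + Y]: columns [x < b] since
    [f = (1 + Y)^(b - x) f'], columns [x >= b] by cancelling [(1 + Y)^(x - b)] against
    [(1 + Y)^(x + c)]. *)
Lemma leftmut_right c : not_div_y f -> has_mult f' 1 0 c -> c <= - b%:Z.
Proof.
move=> nd L; rewrite leNgt; apply/negP => cb; apply: nd.
have [g hg H] : has_mult_dir f' 1 0 c 0 1.
  have := @has_mult_dir_rev _ f' 1 0 c 0 (-1) ltac:(ring) L.
  by rewrite oppr0 opprK.
pose G x y := if x < b%:Z then mulpn 0 1 (absz (b%:Z - x)).-1 f' x y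
  else mulpn 0 1 (absz (b%:Z + c)).-1 g x y.
exists G.
  pose G1 x y := if x < b%:Z then mulpn 0 1 (absz (b%:Z - x)).-1 f' x y else 0.
  have [B hB] : finite_supp G1.
    apply: (@fin_patch _ f' G1 (-1) 0 b%:Z 0 1) => // x y; rewrite /G1; case: ifP; last by rewrite eqxx.
    by move=> _ /mulpn_supp [j hj hgj]; exists j%:Z; split => //; lia.
  have [C hC] := mulpn_fin 0 1 (absz (b%:Z + c)).-1 hg.
  exists (`|B| + `|C|) => x y; rewrite /G; case: ifP => h; last by move/hC; lia.
  by move=> h0; have := hB x y; rewrite /G1 h => /(_ h0); lia.
move=> x y; have [xb|xb] := ltP x b%:Z.
  rewrite (@R1 x y (absz (b%:Z - x))); last by lia.
  have -> : absz (b%:Z - x) = (1 + (absz (b%:Z - x)).-1)%N by lia.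
  rewrite mulpnD; apply: (@mulpn_ext _ 0 1 1) => j _; rewrite mul0r subr0 /G xb.
  by congr (mulpn _ _ _ _ _ _); lia.
have main : forall t : int, f (x + 0 * t) (y + 1 * t) = mulpn 0 1 (absz (b%:Z + c)) g (x + 0 * t) (y + 1 * t).
  apply: (@mulpn_inj_line _ 0 1 (absz (x - b%:Z))) => //; first exact: mulpn_fin.
  move=> t; rewrite mul0r addr0 mul1r -mulpnD -(@R2 x _ (absz (x - b%:Z))); last by lia.
  rewrite (H x _ (absz (x + c)).-1); last by lia.
  by congr (mulpn _ _ _ _ _ _); lia.
have := main 0; rewrite !mulr0 !addr0 => ->.
have -> : absz (b%:Z + c) = (1 + (absz (b%:Z + c)%R).-1)%N by lia.
rewrite mulpnD; apply: (@mulpn_ext _ 0 1 1) => j _; rewrite mul0r subr0 /G ltNge xb /=.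
by congr (mulpn _ _ _ _ _ _); lia.
Qed.

End LeftMut.

Definition in_trapezoid (w s g : int) f := forall x y, f x y != 0 ->
  0 <= x /\ x <= w /\ s * x - g <= y /\ y <= 0.

Lemma in_trapezoid_flip (w s g : int) f : in_trapezoid w s g f -> in_trapezoid w s g (flip s g f).
Proof. by move=> T x y /T; lia. Qed.

Definition top_touch f := exists x, f x 0 != 0.

Variable K : (int -> int -> V) -> Prop.
Hypothesis MC : mutation_class K.
Let Kfin := mc_fin MC.

Lemma class_flip (s g : int) f : K f -> K (flip s g f).
Proof.
move=> Kf; apply: (@class_aff_eq _ _ MC f _ 1 0 s (-1) 0 (- g) Kf) => [x y|].
  by rewrite /flip; congr f; ring.
by right; ring.
Qed.

(* After the left mutation the coordinates are sheared so that the top line is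
   horizontal again; the slope [s] of the bottom line drops by one. *)
Lemma left_step f (w s g : int) (b h h' : nat) :
  K f -> in_trapezoid w s g f -> top_touch f -> top_touch (flip s g f) ->
  has_mult f (-1) 0 b%:Z -> (forall c, has_mult f (-1) 0 c -> c <= b%:Z) -> not_div_y f ->
  has_mult f 0 1 h%:Z -> has_mult (flip s g f) 0 1 h'%:Z ->
  exists f2, [/\ K f2 /\ in_trapezoid w (s - 1) (g - b%:Z) f2,
    top_touch f2 /\ top_touch (flip (s - 1) (g - b%:Z) f2),
    (forall c, has_mult f2 (-1) 0 c -> c <= b%:Z) /\ (forall c, has_mult f2 1 0 c -> c <= - b%:Z),
    not_div_y f2 & has_mult f2 0 1 h%:Z /\ has_mult (flip (s - 1) (g - b%:Z) f2) 0 1 h'%:Z].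
Proof.
move=> Kf T [xt ht] [xb hb] L Lmax nd Lt Lb.
have pm : unimodular (-1) 0 by exists (-1), 0.
have [f' [Kf' R]] := class_mutate MC Kf pm L.
rewrite opprK in R.
pose f2 x y := f' x (y + (x - b%:Z)).
have K2 : K f2.
  apply: (@class_aff_eq _ _ MC f' _ 1 0 1 1 0 (- b%:Z) Kf') => [x y|]; last by left; ring.
  by rewrite /f2; congr f'; ring.
have T2 : in_trapezoid w (s - 1) (g - b%:Z) f2.
  move=> x y h2.
  have [[t ft] [u [hu fu]]] := @mutation_rel_supp _ f f' (-1) 0 b%:Z 0 1 _ _ (Kfin Kf') isT ltac:(ring) R h2.
  move: ft fu; rewrite !mul0r !mul1r ?subr0 ?addr0 => /T ft /T fu.
  by rewrite mulrBl mul1r; move: ft fu; move: (s * x); lia.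
have R' := mutation_rel_sym R; rewrite opprK oppr0 in R'.
have tt : top_touch f2.
  have [_ [u [hu fu]]] := @mutation_rel_supp _ f' f 1 0 (- b%:Z) 0 1 _ _ (Kfin Kf) isT ltac:(ring) R' ht.
  move: fu; rewrite mul0r mul1r add0r addr0 => fu.
  exists xt; rewrite /f2 add0r.
  have [] := T2 xt (u - (xt - b%:Z)); first by rewrite /f2 subrK.
  move=> _ [_ [_ hu2]].
  by have -> : xt - b%:Z = u by clear -hu hu2; lia.
have fl : flip (s - 1) (g - b%:Z) f2 = flip s g f'.
  by apply/funext => x; apply/funext => y; rewrite /flip /f2; congr f'; ring.
have tb : top_touch (flip (s - 1) (g - b%:Z) f2).
  have [[t ft] _] := @mutation_rel_supp _ f' f 1 0 (- b%:Z) 0 1 _ _ (Kfin Kf) isT ltac:(ring) R' hb.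
  move: ft; rewrite mul0r mul1r subr0 subr0 => ft.
  exists xb; rewrite fl /flip subr0.
  have := @in_trapezoid_flip w (s - 1) (g - b%:Z) f2 T2 xb t%:Z; rewrite fl /flip => /(_ ft) hh0.
  have t0 : t%:Z = 0 by clear -hh0; lia.
  by move: ft; rewrite t0 subr0.
have inn F : K F -> in_trapezoid w s g F \/ in_trapezoid w (s - 1) (g - b%:Z) F -> point_ideal 0 F.
  move=> KF' TF; split; first exact: Kfin.
  by move=> x y h0; case: TF => /(_ _ _ h0); lia.
have Rb : mutation_rel (flip s g f) (flip s g f') (-1) 0 b%:Z 0 (-1).
  have E F : flip s g F = aff 1 0 s (-1) 0 (- g) F.
    by apply/funext => x; apply/funext => y; rewrite /aff /flip; congr F; ring.
  rewrite !E.
  have M : mutation_rel (aff 1 0 s (-1) 0 (- g) f) (aff 1 0 s (-1) 0 (- g) f')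
    (-1 * 1 + 0 * s) (-1 * 0 + 0 * -1) (b%:Z + -1 * 0 + 0 * - g) 0 (-1).
    apply: mutation_rel_aff.
    have -> : 1 * 0 + 0 * -1 = 0 :> int by ring.
    by have -> : s * 0 + -1 * -1 = 1 :> int by ring.
  by move=> x y i; have [M1 M2] := M x y i; split => e; [apply: M1|apply: M2]; rewrite -e; ring.
(* After the shear the same mutation has factor [1 + Y^-1], the form that [has_mult_persist]
   expects. *)
have Rt : mutation_rel f f2 (-1) 0 b%:Z 0 (-1).
  have sh i x y : mulpn 0 1 i f2 x y = mulpn 0 1 i f' x (y + (x - b%:Z)).
    elim: i y => // i IH y; rewrite !mulpnS !subr0 !IH.
    by congr (_ + mulpn _ _ _ _ _ _); ring.
  have rv i F x y : mulpn 0 (-1) i F x y = mulpn 0 1 i F x (y + i%:Z).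
    by have := mulpn_rev 0 1 i F x y; rewrite oppr0 mul0r addr0 mul1r.
  move=> x y i; split => e.
    rewrite rv sh; have -> : y + i%:Z + (x - b%:Z) = y by lia.
    by apply R.
  rewrite rv /f2; have -> : x - b%:Z = i%:Z by lia.
  by apply R; lia.
exists f2; split => //.
- split => c Lc.
    apply: (@leftmut_left f f' b R Lmax).
    apply: (@has_mult_aff_eq V f2 _ (-1) 0 c _ _ _ 1 0 (-1) 1 0 b%:Z Lc) => [x y||||]; try ring.
      by rewrite /f2; congr f'; ring.
    by left.
  apply: (@leftmut_right f f' b (Kfin Kf) (Kfin Kf') R c nd).
  apply: (@has_mult_aff_eq V f2 _ 1 0 c _ _ _ 1 0 (-1) 1 0 b%:Z Lc) => [x y||||]; try ring.
    by rewrite /f2; congr f'; ring.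
  by left.
- move=> [g2 [B hB] E2]; apply: (@leftmut_ndiv f f' b R Lmax).
  exists (fun x y => g2 x (y - (x - b%:Z))).
    by exists (`|B| + `|B| + b%:Z) => x y /hB; lia.
  move=> x y; have -> : f' x y = f2 x (y - (x - b%:Z)) by rewrite /f2 subrK.
  by rewrite E2 /mulp subr0 addrAC.
split; first by apply: (has_mult_persist _ _ Rt Lt); apply: inn; auto.
rewrite fl; apply: (has_mult_persist _ _ Rb Lb); apply: inn.
- exact: class_flip.
- by left; apply: in_trapezoid_flip.
- by rewrite -fl; exact: class_flip.
- by right; rewrite -fl; apply: in_trapezoid_flip.
Qed.

End LeftStep.

(** * Top and bottom multiplicities both above half the width *)

Section Cases.
Variable V : zmodType.
Implicit Types f F G : int -> int -> V.
Variable K : (int -> int -> V) -> Prop.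
Hypothesis MC : mutation_class K.
Let Kfin := mc_fin MC.
Variable w : int.
Hypothesis W : min_width K w.

Definition solved := exists f v1 v2, K f /\ mults_ok f v1 v2.

Lemma ends f : K f -> (forall x y, f x y != 0 -> 0 <= x /\ x <= w) ->
  (exists y, f 0 y != 0) /\ (exists y, f w y != 0).
Proof.
move=> Kf S; have [x1 [y1 [x2 [y2 [h1 [h2 h3]]]]]] := W Kf.
have [a1 a2] := S _ _ h1; have [b1 b2] := S _ _ h2.
have e1 : x1 = w by lia.
have e2 : x2 = 0 by lia.
by split; [exists y2; rewrite -e2|exists y1; rewrite -e1].
Qed.

Lemma in_trapezoid_width f (s g : int) : K f -> in_trapezoid w s g f -> s * w <= g.
Proof.
move=> Kf T; have [|_ [y hy]] := @ends f Kf; first by move=> x y /T; lia.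
by have := T _ _ hy; lia.
Qed.

Definition mult_max f (h : nat) := has_mult f 0 1 h%:Z /\ forall c, has_mult f 0 1 c -> c <= h%:Z.

Lemma in_trapezoid_mult f (s g : int) : in_trapezoid w s g f -> top_touch f -> exists h : nat,
  [/\ mult_max f h, h%:Z <= w & exists a b : int, [/\ f a 0 != 0, f b 0 != 0 & h%:Z <= b - a]].
Proof.
move=> T [xt ht]; have [|h [h1 h2 h3 h4]] := @top_mult V f w xt _ ht; last by exists h.
by move=> x y /T; lia.
Qed.

Lemma in_trapezoid_row f (s g : int) (h : nat) : in_trapezoid w s g f -> top_touch f -> mult_max f h ->
  h%:Z <= w /\ exists a b : int, [/\ f a 0 != 0, f b 0 != 0, h%:Z <= b - a, 0 <= a & b <= w].
Proof.
move=> T tt [h1 h2]; have [h' [[h3 h4] h5 [a [b [fa fb hab]]]]] := in_trapezoid_mult T tt.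
have e := h2 _ h3; have e' := h4 _ h1.
split; first by lia.
exists a, b; split => //; first by lia.
  by have := T _ _ fa; lia.
by have := T _ _ fb; lia.
Qed.

Variable x0 : int.
Hypotheses (hw1 : 2 * x0 <= w) (hw2 : w <= 2 * x0 + 1) (x00 : 0 <= x0).

(** Seeks the last column up to [xb] whose gap [g - s x] has room for [h + h'], with a support point
    near both left corners. Right corners need no search: as [h, h' > x0], the right ends of the
    extreme rows serve. *)
Lemma column_choice (s : nat) f (g xb : int) (h h' : nat) : (0 < s)%N ->
  K f -> in_trapezoid w s%:Z g f -> top_touch f -> top_touch (flip s%:Z g f) ->
  mult_max f h -> mult_max (flip s%:Z g f) h' -> x0 < h%:Z -> x0 < h'%:Z -> xb <= x0 ->
  xb = x0 \/ g - h%:Z - h'%:Z < s%:Z * xb ->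
  exists x : int, [/\ s%:Z * x <= g - h%:Z - h'%:Z /\ x <= xb,
    exists xa ya, f xa ya != 0 /\ xa - ya <= x,
    exists xa ya, flip s%:Z g f xa ya != 0 /\ xa - ya <= x &
    x = xb \/ g - h%:Z - h'%:Z < s%:Z * (x + 1)].
Proof.
move=> s0 Kf T tt tb mh mh' xh xh' xbx alt.
have [hw [a [b [fa fb hab a0 bw]]]] := in_trapezoid_row T tt mh.
have [hw' [a' [b' [fa' fb' hab' a0' bw']]]] := in_trapezoid_row (in_trapezoid_flip T) tb mh'.
have gw := in_trapezoid_width Kf T.
have [zx|zx] := leP (s%:Z * xb) (g - h%:Z - h'%:Z).
  have xbe : xb = x0 by case: alt => // z1; move: zx; rewrite leNgt z1.
  exists xb; split; [by split|exists a, 0|exists a', 0|by left]; split => //; lia.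
(* Without room at [xb], the mutations at top and bottom each supply a deep support point, and
   [s w <= g] with [h, h' <= w] leaves only [s <= 3]. *)
have [xs [ys [fs hs]]] : exists x y, f x y != 0 /\ w <= x - (y + h%:Z).
  by apply: (mutated_extent_strip MC W Kf _ mh.1) => x y /T; lia.
have [xf [yf [ff hf]]] : exists x y, flip s%:Z g f x y != 0 /\ w <= x - (y + h'%:Z).
  by apply: (mutated_extent_strip MC W (class_flip MC _ _ Kf) _ mh'.1) => x y /(in_trapezoid_flip T); lia.
have Ts := T _ _ fs; have Tf := in_trapezoid_flip T ff.
have fs' : flip s%:Z g f xs (s%:Z * xs - g - ys) != 0.
  by rewrite /flip; have -> : s%:Z * xs - g - (s%:Z * xs - g - ys) = ys by ring.
have {}ff : f xf (s%:Z * xf - g - yf) != 0 by [].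
clear T tt tb mh mh' alt.
case: s s0 gw zx ff fs' Ts Tf fa' fb' => [|[|[|[|s]]]] s0 gw zx ff fs' Ts Tf fa' fb' //.
(* For [s = 1] the deep points give [g - h >= w] and [g - h' >= w], so [w - h] and [w - h'] are at
   most this column. *)
- exists (g - h%:Z - h'%:Z); split.
  + split; lia.
  + exists a, 0; split => //; lia.
  + exists a', 0; split => //; lia.
  + by right; lia.
- have [x hx] : exists x : int, 2 * x <= g - h%:Z - h'%:Z /\ g - h%:Z - h'%:Z < 2 * (x + 1).
    by exists ((g - h%:Z - h'%:Z) %/ 2)%Z; lia.
  exists x; split.
  + split; lia.
  (* If [a > x] then [x < w - h], and the deep point of the flipped array has
     [xa - ya <= g - w - h' <= x]. *)
  + have [c1|c1] := leP a x; first by exists a, 0; split => //; lia.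
    by exists xf, (2%:Z * xf - g - yf); split => //; lia.
  + have [c1|c1] := leP a' x; first by exists a', 0; split => //; lia.
    by exists xs, (2%:Z * xs - g - ys); split => //; lia.
  + by right; lia.
- have [x hx] : exists x : int, 3 * x <= g - h%:Z - h'%:Z /\ g - h%:Z - h'%:Z < 3 * (x + 1).
    by exists ((g - h%:Z - h'%:Z) %/ 3)%Z; lia.
  exists x; split.
  + split; lia.
  + exists a, 0; split => //; lia.
  + exists a', 0; split => //; lia.
  + by right; lia.
exfalso.
have e1 : s.+4%:Z * xb <= s.+4%:Z * x0 by rewrite ler_wpM2l.
have e2 : 2 * (s.+4%:Z * x0) <= s.+4%:Z * w by rewrite mulrCA ler_wpM2l.
have e3 : 4 * w <= s.+4%:Z * w by rewrite ler_wpM2r //; lia.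
clear -e1 e2 e3 gw zx hw hw' x00 hw1; lia.
Qed.

(* If the column allowed by the top and bottom multiplicities is too close to the
   left edge, a left mutation lowers [s]; at [s = 0] the lemma [parallel] applies. *)
Lemma both_bad (s : nat) f (g xb : int) (h h' : nat) :
  K f -> in_trapezoid w s%:Z g f -> top_touch f -> top_touch (flip s%:Z g f) ->
  mult_max f h -> mult_max (flip s%:Z g f) h' -> x0 < h%:Z -> x0 < h'%:Z -> not_div_y f ->
  (forall c, has_mult f (-1) 0 c -> c <= xb) -> (forall c, has_mult f 1 0 c -> c <= - xb) -> xb <= x0 ->
  xb = x0 \/ g - h%:Z - h'%:Z < s%:Z * xb -> solved.
Proof.
elim: s f g xb h h' => [|s IH] f g xb h h' Kf T tt tb mh mh' xh xh' nd Lf Rt xbx alt.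
  have [hh _] := mh; have [hh' _] := mh'.
  have Z : h%:Z + h'%:Z <= g by apply: (parallel MC W Kf _ hh hh') => x y /T; lia.
  have [hw [a [b [fa fb hab a0 bw]]]] := in_trapezoid_row T tt mh.
  have [hw' [a' [b' [fa' fb' hab' a0' bw']]]] := in_trapezoid_row (in_trapezoid_flip T) tb mh'.
  exists f, xb, (- h%:Z); split => //.
  (* For [s = 0] the lemma [parallel] gives room in every column, which excludes the second
     alternative. *)
  have xbe : xb = x0 by case: alt => //; lia.
  apply: (@mults_ok_of_upper _ f 0 g).
  - apply: (@upper_ok_corners _ f w xb _ a 0 b 0) => //; try lia; last exact: mh.2.
    by move=> x y /T; lia.
  - apply: (@upper_ok_corners _ _ w xb _ a' 0 b' 0) => //; try lia; last by move=> c /mh'.2; lia.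
    by move=> x y /(in_trapezoid_flip T); lia.
  - exact: Lf.
  by move=> c /Rt; lia.
have [x [[xz xxb] [xa [ya [fxa cutE]]] [xc [yc [fxc cutF]]] fin_or]] :=
  column_choice (ltn0Sn s) Kf T tt tb mh mh' xh xh' xbx alt.
have [hw [a [b [fa fb hab a0 bw]]]] := in_trapezoid_row T tt mh.
have [hw' [a' [b' [fa' fb' hab' a0' bw']]]] := in_trapezoid_row (in_trapezoid_flip T) tb mh'.
have TA := T _ _ fxa; have TC := in_trapezoid_flip T fxc.
have [Lx|nLx] := pselect (forall c, has_mult f (-1) 0 c -> c <= x).
  exists f, x, (- h%:Z); split => //; apply: (@mults_ok_of_upper _ f s.+1%:Z g).
  - apply: (@upper_ok_corners _ f w x _ xa ya b 0) => //; try (clear -TA cutE xxb xbx xh hab a0 bw hw2; lia); last exact: mh.2.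
    by move=> ? ? /T; lia.
  - have r' : h'%:Z <= g - s.+1%:Z * x - h%:Z by clear -xz; lia.
    apply: (@upper_ok_corners _ _ w x _ xc yc b' 0) => //; try (clear -TC cutF xxb xbx xh' hab' a0' bw' hw2 r'; lia).
      by move=> ? ? /(in_trapezoid_flip T); lia.
    by move=> c /mh'.2; clear -r'; lia.
  - exact: Lx.
  by move=> c /Rt; clear -xxb; lia.
have x_ge0 : 0 <= x by clear -TA cutE; lia.
have [c0 [Lc0 c0x]] : exists c : nat, has_mult f (-1) 0 c%:Z /\ x < c%:Z.
  apply: contrapT => H; apply: nLx => c Lc; rewrite leNgt; apply/negP => cx.
  by apply: H; exists (absz c); have -> : (absz c)%:Z = c by clear -cx x_ge0; lia.
have [|i /Lf Li|m [Lm mmax]] := @max_nat (fun c : nat => has_mult f (-1) 0 c%:Z) (absz xb).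
- by apply: has_mult_nonpos => u v /T; lia.
- by clear -Li; lia.
have mc0 := mmax _ Lc0; have mxb := Lf _ Lm.
have Lm' : forall c, has_mult f (-1) 0 c -> c <= m%:Z.
  move=> c Lc; have [cn|cp] := leP c 0; first by clear -cn; lia.
  have ec : c = (absz c)%:Z by clear -cp; lia.
  by rewrite ec in Lc; have := mmax _ Lc; clear -ec; lia.
have [f2 [[K2 T2] [tt2 tb2] [L2 R2] nd2 [mt2 mb2]]] :=
  left_step MC Kf T tt tb Lm Lm' nd mh.1 mh'.1.
have es : s.+1%:Z - 1 = s%:Z by clear; lia.
rewrite es in T2 tb2 mb2.
have [h2 [mh2 _ _]] := in_trapezoid_mult T2 tt2.
have [h2' [mh2' _ _]] := in_trapezoid_mult (in_trapezoid_flip T2) tb2.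
have q1 := mh2.2 _ mt2; have q2 := mh2'.2 _ mb2.
apply: (IH f2 (g - m%:Z) m%:Z h2 h2') => //.
- by clear -q1 xh; lia.
- by clear -q2 xh'; lia.
- by clear -mxb xbx; lia.
(* The column [m > x] had no room before, and old and new gaps agree at [m], so the invariant passes
   on with [xb = m]. *)
right.
have zz : g - h%:Z - h'%:Z < s.+1%:Z * (x + 1).
  by case: fin_or => // e; exfalso; clear -e mxb mc0 c0x; lia.
have mm : s.+1%:Z * (x + 1) <= s.+1%:Z * m%:Z by rewrite ler_wpM2l //; clear -mc0 c0x; lia.
have : s.+1%:Z * m%:Z = s%:Z * m%:Z + m%:Z by rewrite -es mulrBl mul1r subrK.
clear -zz mm q1 q2; lia.
Qed.

End Cases.

(** * At most one of the top and bottom multiplicities above half the width *)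

Section Cases.
Variable V : zmodType.
Implicit Types f F G : int -> int -> V.
Variable K : (int -> int -> V) -> Prop.
Hypothesis MC : mutation_class K.
Let Kfin := mc_fin MC.
Variables w x0 : int.
Hypothesis W : min_width K w.
Hypotheses (hw1 : 2 * x0 <= w) (hw2 : w <= 2 * x0 + 1) (x00 : 0 <= x0).

Definition corners f :=
  (exists xa ya, f xa ya != 0 /\ xa - ya <= x0) /\
  (exists xb yb, f xb yb != 0 /\ (w - xb) - yb <= x0).

Lemma triangle_solved f (k : int) : K f -> in_triangle (w + k) f -> 2 * k <= w -> solved K.
Proof. by move=> Kf T k2; exists f, k, k; split => //; apply: (triangle_ok MC W Kf T k2). Qed.

(** Depth [x0] suffices on both sides of column [x0]. If its gap is below [2 * x0], then [s = 0]
    contradicts the vertical extent, [s >= 2] contradicts [s w <= g], and [s = 1] is a triangle of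
    size [g < 3 * x0]. *)
Lemma none_bad (s : nat) f (g : int) (h h' : nat) : K f -> in_trapezoid w s%:Z g f ->
  corners f -> corners (flip s%:Z g f) -> mult_max f h -> mult_max (flip s%:Z g f) h' ->
  h%:Z <= x0 -> h'%:Z <= x0 -> (forall c, has_mult f (-1) 0 c -> c <= x0) ->
  (forall c, has_mult f 1 0 c -> c <= - x0) -> solved K.
Proof.
move=> Kf T [[xa [ya [fa ha]]] [xb [yb [fb hb]]]] [[xc [yc [fc hc]]] [xd [yd [fd hd]]]] mh mh' hx hx' Lf Rt.
have gw := in_trapezoid_width W Kf T.
have Ta := T _ _ fa; have Tb := T _ _ fb.
have Tc := in_trapezoid_flip T fc; have Td := in_trapezoid_flip T fd.
have [gap|gap] := leP (2 * x0) (g - s%:Z * x0).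
  exists f, x0, (- x0); split => //; apply: (@mults_ok_of_upper _ f s%:Z g).
  - apply: (@upper_ok_corners _ f w x0 _ xa ya xb yb) => //; try (clear -Ta Tb ha hb hw1 hw2; lia).
      by move=> ? ? /T; lia.
    by move=> c /mh.2; clear -hx; lia.
  - apply: (@upper_ok_corners _ _ w x0 _ xc yc xd yd) => //; try (clear -Tc Td hc hd hw1 hw2 gap; lia).
      by move=> ? ? /(in_trapezoid_flip T); lia.
    by move=> c /mh'.2; clear -hx' gap; lia.
  - exact: Lf.
  by move=> c /Rt; clear; lia.
case: s T mh' gw gap {fc fd Tc Td Ta Tb} => [|[|s]] T mh' gw gap.
- exfalso; have [x1 [y1 [x2 [y2 [/T f1 [/T f2 h12]]]]]] := width_y MC W Kf.
  by clear -f1 f2 h12 gap hw1 x00; lia.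
- apply: (@triangle_solved (fun x y => f x (- y)) (g - w)); last by clear -gap hw1 hw2; lia.
    apply: (@class_aff_eq _ _ MC f _ 1 0 0 (-1) 0 0 Kf) => [x y|]; first by congr f; ring.
    by right.
  by move=> x y /T; clear; lia.
exfalso.
have e1 : 2 * (w - x0) <= s.+2%:Z * (w - x0) by rewrite ler_wpM2r //; clear -hw1 x00; lia.
by clear -e1 gw gap hw1 hw2 x00; lia.
Qed.

Lemma one_bad (s : nat) f (g : int) (h h' : nat) : K f -> in_trapezoid w s%:Z g f ->
  top_touch f -> top_touch (flip s%:Z g f) ->
  corners (flip s%:Z g f) -> mult_max f h -> mult_max (flip s%:Z g f) h' ->
  x0 < h%:Z -> h'%:Z <= x0 -> not_div_y f -> (forall c, has_mult f (-1) 0 c -> c <= x0) ->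
  (forall c, has_mult f 1 0 c -> c <= - x0) -> solved K.
Proof.
move=> Kf T tt tb [[xc [yc [fc hc]]] [xd [yd [fd hd]]]] mh mh' hx hx' nd Lf Rt.
have gw := in_trapezoid_width W Kf T.
have [hw [a [b [fa fb hab a0 bw]]]] := in_trapezoid_row T tt mh.
have Tc := in_trapezoid_flip T fc; have Td := in_trapezoid_flip T fd.
have Sx : forall x y, f x y != 0 -> 0 <= x by move=> x y /T; lia.
have Sf : forall x y, f x y != 0 -> 0 <= x /\ x <= w /\ y <= 0 by move=> x y /T; lia.
have Sg : forall x y, flip s%:Z g f x y != 0 -> 0 <= x /\ x <= w /\ y <= 0.
  by move=> x y /(in_trapezoid_flip T); lia.
have [gap|gap] := leP (h%:Z + x0) (g - s%:Z * x0).
  exists f, x0, (- h%:Z); split => //; apply: (@mults_ok_of_upper _ f s%:Z g).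
  - apply: (@upper_ok_corners _ f w x0 _ a 0 b 0) => //; try (clear -a0 bw hab hw hx hw2 hw1; lia).
    exact: mh.2.
  - apply: (@upper_ok_corners _ _ w x0 _ xc yc xd yd) => //; try (clear -Tc Td hc hd hw1 hw2 gap; lia).
    by move=> c /mh'.2; clear -hx' gap; lia.
  - exact: Lf.
  by move=> c /Rt; clear; lia.
have [xs [ys [fs hs]]] := mutated_extent_strip MC W Kf Sx mh.1.
have Ts := T _ _ fs.
case: s T tb fc fd mh' gw gap Tc Td Sg Ts => [|[|[|s]]] T tb fc fd mh' gw gap Tc Td Sg Ts.
(* For [s = 0] the top mutation cuts the rectangle along [x + y = w - h]: a triangle of size
   [w + (g - h)] with [g - h < x0]. *)
- have p01 : unimodular 0 1 by exists 0, 1.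
  have [f1 [K1 R]] := class_mutate MC Kf p01 mh.1.
  apply: (@triangle_solved (fun x y => f1 x (y - g)) (g - h%:Z)); last by clear -gap hw1; lia.
    apply: (@class_aff_eq _ _ MC f1 _ 1 0 0 1 0 (- g) K1) => [x y|]; first by congr f1; ring.
    by left.
  move=> x y h1; have [[t /T ft] [u [hu /T fu]]] := mutation_rel_supp_perp MC K1 p01 R h1.
  by clear -ft hu fu; lia.
(* For [s = 1] the deep point gives [w <= g - h], too much for the gap. *)
- by exfalso; clear -Ts hs gap hw1; lia.
(* The column where the gap [g - 2 k'] equals [h + (w - k')]: depth [h] below the top and [w - k']
   above the bottom. *)
- set k' := g - w - h%:Z.
  have k0 : w - h%:Z <= k' by rewrite /k'; clear -gw; lia.
  have k1 : k' + w < h%:Z + 3 * x0 - h%:Z by rewrite /k'; clear -gap; lia.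
  (* A left mutation of order [m] keeps the top multiplicity and makes the bottom slope [1]; the
     extent after a further top mutation then forces [w <= g - m - h]. *)
  have L2 : forall c, has_mult f (-1) 0 c -> c <= k'.
    move=> c0 Lc0; rewrite leNgt; apply/negP => c0k.
    have [|i /Lf Li|m [Lm mmax]] := @max_nat (fun c : nat => has_mult f (-1) 0 c%:Z) (absz x0).
    - by apply: has_mult_nonpos => u v /Sx; clear; lia.
    - by clear -Li; lia.
    have Lm' : forall c, has_mult f (-1) 0 c -> c <= m%:Z.
      move=> c Lc; have [cn|cp] := leP c 0; first by clear -cn; lia.
      have ec : c = (absz c)%:Z by clear -cp; lia.
      by rewrite ec in Lc; have := mmax _ Lc; clear -ec; lia.
    have [f2 [[K2 T2] _ _ _ [mt2 _]]] := left_step MC Kf T tt tb Lm Lm' nd mh.1 mh'.1.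
    have [|x2 [y2 [/T2 fs2 hs2]]] := mutated_extent_strip MC W K2 _ mt2.
      by move=> x y /T2; clear; lia.
    by have := Lm' _ Lc0; move: c0k; rewrite /k'; clear -fs2 hs2; lia.
  exists f, k', (- h%:Z); split => //; apply: (@mults_ok_of_upper _ f 2 g).
  - apply: (@upper_ok_corners _ f w k' _ a 0 b 0) => //; try (clear -a0 bw hab hw hx hw2 hw1 k0 k1; lia).
    exact: mh.2.
  - have rE : g - 2 * k' - h%:Z = w - k' by rewrite /k'; ring.
    apply: (@upper_ok_corners _ _ w k' _ xs (2 * xs - g - ys) xd yd) => //.
    + by have -> : flip 2 g f xs (2 * xs - g - ys) = f xs ys by rewrite /flip; congr f; ring.
    + by rewrite /k'; clear -Ts hs; lia.
    + by rewrite rE /k'; move: k1 k0; rewrite /k'; clear -Ts hs hw1; lia.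
    + by clear -hd hw1 hw2 Td k1; lia.
    + by rewrite rE; clear -hd k1 hw1; lia.
    by move=> c /mh'.2; rewrite rE; clear -hx' k1 hw1; lia.
  - exact: L2.
  by move=> c /Rt; clear -k1 hw1; lia.
exfalso.
have e1 : 3 * (w - x0) <= s.+3%:Z * (w - x0) by rewrite ler_wpM2r //; clear -hw1 x00; lia.
by clear -e1 gw gap hw1 hw2 x00 hw; lia.
Qed.

End Cases.

(** * Choice of a minimal representative and of optimal lines *)

Section Minimal.
Variable V : zmodType.
Implicit Types f F G : int -> int -> V.
Variable K : (int -> int -> V) -> Prop.
Hypothesis MC : mutation_class K.
Let Kfin := mc_fin MC.

Definition strip (w : int) f := forall x y, f x y != 0 -> 0 <= x /\ x <= w.

Lemma class_hshift f (e : int) : K f -> K (fun x y => f (x + e) y).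
Proof.
move=> Kf; apply: (@class_aff_eq _ _ MC f _ 1 0 0 1 e 0 Kf) => [x y|]; first by congr f; ring.
by left.
Qed.

Lemma min_width_ex : (exists f, K f) -> exists w : nat, min_width K w%:Z /\
  exists f, K f /\ strip w%:Z f.
Proof.
move=> [f0 K0].
have [|n [[f1 [K1 S1]] nmin]] := @min_nat (fun n => exists f, K f /\ strip n%:Z f).
  have [B hB] := Kfin K0.
  exists (absz B + absz B)%N, (fun x y => f0 (x + - `|B|) y); split; first exact: class_hshift.
  by move=> x y /hB; clear; lia.
exists n; split; last by exists f1.
move=> f Kf; apply: contrapT => H.
have {}H x1 y1 x2 y2 : f x1 y1 != 0 -> f x2 y2 != 0 -> x1 - x2 < n%:Z.
  move=> h1 h2; rewrite ltNge; apply/negP => h3; apply: H.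
  by exists x1, y1, x2, y2.
have [xa [ya fa]] := mc_neq0 MC Kf.
have [B hB] := Kfin Kf.
have [|m [[x [y [fxy ex]]] mmin]] :=
  @min_nat (fun m => exists x y, f x y != 0 /\ x = m%:Z - `|B|).
  exists (absz (xa + `|B|)%R), xa, ya; split => //; have := hB _ _ fa; clear; lia.
case: n nmin H {f1 K1 S1} => [|n] nmin H; first by have := H _ _ _ _ fa fa; clear; lia.
suff : (n.+1 <= n)%N by rewrite ltnn.
apply: nmin; exists (fun u v => f (u + x) v); split; first exact: class_hshift.
move=> u v fuv; have h1 := H _ _ _ _ fuv fxy.
have := mmin (absz (u + x + `|B|)%R).
have := hB _ _ fuv => hb.
move/(_ ltac:(exists (u + x), v; split => //; clear -hb; lia)).
clear -hb ex h1; lia.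
Qed.

Variable w : int.
Hypothesis W : min_width K w.

(* Its minimum over charts of minimal width bounds the left and right multiplicities
   by half the width. *)
Definition ends_len f (L : int) := exists l0 u0 l1 u1 : int,
  [/\ forall y, f 0 y != 0 -> l0 <= y /\ y <= u0,
      forall y, f w y != 0 -> l1 <= y /\ y <= u1 & (u0 - l0) + (u1 - l1) = L].

Lemma ends_len_ge0 f L : K f -> strip w f -> ends_len f L -> 0 <= L.
Proof.
move=> Kf S [l0 [u0 [l1 [u1 [h0 h1 e]]]]].
have [[y0 /h0 hy0] [y1 /h1 hy1]] := ends W Kf S.
clear -e hy0 hy1; lia.
Qed.

Lemma min_len_ex : (exists f, K f /\ strip w f) -> exists L : int,
  (exists f, [/\ K f, strip w f & ends_len f L]) /\
  forall f L', K f -> strip w f -> ends_len f L' -> L <= L'.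
Proof.
move=> [f0 [K0 S0]].
have [|n [[f1 H1] nmin]] := @min_nat (fun n => exists f, [/\ K f, strip w f & ends_len f n%:Z]).
  have [B hB] := Kfin K0.
  exists (absz B + absz B + (absz B + absz B))%N, f0; split => //.
  exists (- `|B|), `|B|, (- `|B|), `|B|; split => [y /hB|y /hB|]; clear; lia.
exists n%:Z; split; first by exists f1.
move=> f L Kf Sf E; have L0 := ends_len_ge0 Kf Sf E.
have eL : L = (absz L)%:Z by clear -L0; lia.
by rewrite eL lez_nat; apply: nmin; exists f; rewrite -eL.
Qed.

Variable L : int.
Hypothesis minL : forall f L', K f -> strip w f -> ends_len f L' -> L <= L'.

Definition good f := [/\ K f, strip w f & ends_len f L].

Lemma good_left f c : 0 <= w -> good f -> has_mult f (-1) 0 c -> 2 * c <= w.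
Proof.
move=> w0 [Kf Sf [l0 [u0 [l1 [u1 [h0 h1 e]]]]]] Lc.
have pm : unimodular (-1) 0 by exists (-1), 0.
have [f' [K' R]] := class_mutate MC Kf pm Lc.
have S' x y : f' x y != 0 -> (exists s : nat, f x (y - s%:Z) != 0) /\
    (exists s : int, c - x <= s /\ f x (y + s) != 0).
  move=> h; have [[s fs] [t [ht ft]]] := mutation_rel_supp_perp MC K' pm R h.
  split; [exists s|exists t].
    by move: fs; rewrite mul0r subr0 mulN1r.
  split; first by clear -ht; lia.
  by move: ft; rewrite mul0r addr0 mulN1r opprK.
have /(minL K') : ends_len f' (L - 2 * c + w).
  exists l0, (u0 - c), l1, (u1 + w - c); split; last by rewrite -e; ring.
    by move=> y /S' [[s /h0 hs] [t [ht /h0 ft]]]; clear -hs ht ft; lia.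
  by move=> y /S' [[s /h1 hs] [t [ht /h1 ft]]]; clear -hs ht ft; lia.
have S1 : strip w f' by move=> x y /S' [[s /Sf]].
by move=> /(_ S1); clear; lia.
Qed.

(** The quotient by [1 + Y] would have both vertical edges shorter by one. *)
Lemma good_ndiv f : good f -> not_div_y f.
Proof.
move=> [Kf Sf [l0 [u0 [l1 [u1 [h0 h1 e]]]]]] [g fg E].
have p01 : unimodular 0 1 by exists 0, 1.
have Kg : K g by apply: (@class_div _ _ MC f g 1 0 0 1).
have S' x y : g x y != 0 -> (exists s : nat, f x (y - s%:Z) != 0) /\
    (exists s : nat, f x (y + s.+1%:Z) != 0).
  move=> h; have [s hs] := @mulp_left _ 0 1 g x y isT fg h.
  have [t ht] := @mulp_right _ 0 1 g x y isT fg h.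
  move: hs ht; rewrite !mul0r !mul1r ?subr0 ?addr0 -!E => hs ht.
  by split; [exists s|exists t].
have /(minL Kg) : ends_len g (L - 2).
  exists l0, (u0 - 1), l1, (u1 - 1); split; last by rewrite -e; ring.
    by move=> y /S' [[s /h0 hs] [t /h0 ft]]; clear -hs ft; lia.
  by move=> y /S' [[s /h1 hs] [t /h1 ft]]; clear -hs ft; lia.
have S1 : strip w g by move=> x y /S' [[s /Sf]].
by move=> /(_ S1); clear; lia.
Qed.

Lemma good_vshear f (k e : int) : good f -> good (fun x y => f x (y + (k * x + e))).
Proof.
move=> [Kf Sf [l0 [u0 [l1 [u1 [h0 h1 E]]]]]]; split.
- apply: (@class_aff_eq _ _ MC f _ 1 0 k 1 0 e Kf) => [x y|]; first by congr f; ring.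
  by left; ring.
- by move=> x y /Sf.
exists (l0 - e), (u0 - e), (l1 - (k * w + e)), (u1 - (k * w + e)); split.
- by move=> y /h0; clear; lia.
- by move=> y /h1; clear; lia.
by rewrite -E; ring.
Qed.

Lemma good_flip f (s g : int) : good f -> good (flip s g f).
Proof.
move=> [Kf Sf [l0 [u0 [l1 [u1 [h0 h1 E]]]]]]; split; first exact: class_flip.
- by move=> x y /Sf.
exists (- g - u0), (- g - l0), (s * w - g - u1), (s * w - g - l1); split.
- by move=> y /h0; clear; lia.
- by move=> y /h1; clear; lia.
by rewrite -E; ring.
Qed.

Lemma good_refl f : good f -> good (fun x y => f (w - x) y).
Proof.
move=> [Kf Sf [l0 [u0 [l1 [u1 [h0 h1 E]]]]]]; split.
- apply: (@class_aff_eq _ _ MC f _ (-1) 0 0 1 w 0 Kf) => [x y|]; first by congr f; ring.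
  by right; ring.
- by move=> x y /Sf; clear; lia.
exists l1, u1, l0, u0; split.
- by move=> y; rewrite subr0 => /h1.
- by move=> y; rewrite subrr => /h0.
by rewrite -E; ring.
Qed.

Lemma good_right f c : 0 <= w -> good f -> has_mult f 1 0 c -> 2 * (w + c) <= w.
Proof.
move=> w0 gf Lc; apply: (good_left w0 (good_refl gf)).
apply: (@has_mult_aff_eq V f _ 1 0 c _ _ _ (-1) 0 0 1 w 0 Lc) => [x y||||]; try ring.
  by congr f; ring.
by right; ring.
Qed.

Variable x0 : int.
Hypotheses (hw1 : 2 * x0 <= w) (hw2 : w <= 2 * x0 + 1) (x00 : 0 <= x0).

(* The line minimizes its height at the middle column [w / 2]; comparing with the
   lines of slope one more and one less yields the two corner points. *)
Lemma optimal_line f : good f -> exists k e : int,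
  [/\ forall x y, f x y != 0 -> y <= k * x + e,
      top_touch (fun x y => f x (y + (k * x + e))) &
      corners w x0 (fun x y => f x (y + (k * x + e)))].
Proof.
move=> gf; have [Kf Sf _] := gf.
have [[y0 fy0] [y1 fy1]] := ends W Kf Sf.
have [B hB] := Kfin Kf.
(* Twice the height at [w / 2], measured from one point of each vertical edge so that it is a
   natural number. *)
pose P (n : nat) := exists k e : int, (forall x y, f x y != 0 -> y <= k * x + e) /\
  (2 * e + k * w) - (y0 + y1) = n%:Z.
have [|n [[k [e [U En]]] nmin]] := @min_nat P.
  exists (absz (2 * `|B| - (y0 + y1))%R), 0, `|B|; split.
    by move=> x y /hB; clear; lia.
  have := hB _ _ fy0; have := hB _ _ fy1; clear; lia.
have opt k' e' : (forall x y, f x y != 0 -> y <= k' * x + e') -> 2 * e + k * w <= 2 * e' + k' * w.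
  move=> U'; have q0 := U' _ _ fy0; have q1 := U' _ _ fy1.
  have : (n <= absz (2 * e' + k' * w - (y0 + y1))%R)%N.
    by apply: nmin; exists k', e'; split => //; clear -q0 q1; lia.
  clear -q0 q1 En; lia.
have tr x y : f x (y - (k * x + e) + (k * x + e)) = f x y by rewrite subrK.
exists k, e; split => //.
- apply: contrapT => H.
  have := opt k (e - 1); move/(_ _)/wrap => -[x y fxy|]; last by clear; lia.
  have := U _ _ fxy; rewrite le_eqVlt => /orP [/eqP ey|]; last by clear; lia.
  by exfalso; apply: H; exists x; rewrite add0r -ey.
(* Without a left corner point, the line of slope one more crossing this one at [x = x0 + 1] also
   bounds the support, and is lower at [w / 2] because [w < 2 * (x0 + 1)]. The right corner is
   symmetric. *)
- split; apply: contrapT => H.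
    have := opt (k + 1) (e - x0 - 1); move/(_ _)/wrap => -[x y fxy|]; last by clear -hw2; lia.
    rewrite leNgt; apply/negP => hy; apply: H.
    by exists x, (y - (k * x + e)); rewrite tr; split => //; clear -hy; lia.
  have := opt (k - 1) (e + (w - x0 - 1)); move/(_ _)/wrap => -[x y fxy|]; last by clear -hw2; lia.
  rewrite leNgt; apply/negP => hy; apply: H.
  by exists x, (y - (k * x + e)); rewrite tr; split => //; clear -hy; lia.
Qed.

Lemma good_solved_s (s : nat) f (g : int) : 0 <= w -> good f -> in_trapezoid w s%:Z g f ->
  top_touch f -> top_touch (flip s%:Z g f) -> corners w x0 f -> corners w x0 (flip s%:Z g f) ->
  solved K.
Proof.
move=> w0 gf T tt tb cf cb.
have gF := good_flip s%:Z g gf.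
have [h [mh _ _]] := in_trapezoid_mult T tt.
have [h' [mh' _ _]] := in_trapezoid_mult (in_trapezoid_flip T) tb.
have Lf F : good F -> forall c, has_mult F (-1) 0 c -> c <= x0.
  by move=> gF0 c /(good_left w0 gF0); clear -hw2; lia.
have Rt F : good F -> forall c, has_mult F 1 0 c -> c <= - x0.
  by move=> gF0 c /(good_right w0 gF0); clear -hw1 hw2; lia.
have [Kf _ _] := gf; have [KF' _ _] := gF.
have [hx|hx] := leP h%:Z x0; have [hx'|hx'] := leP h'%:Z x0.
- by apply: (none_bad MC W hw1 hw2 x00 Kf T cf cb mh mh') => //; [apply: Lf|apply: Rt].
- apply: (@one_bad _ _ MC _ _ W hw1 hw2 x00 s (flip s%:Z g f) g h' h) => //.
  + exact: in_trapezoid_flip.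
  + by rewrite flipK.
  + by rewrite flipK.
  + by rewrite flipK.
  + exact: good_ndiv.
  + exact: Lf.
  + exact: Rt.
- apply: (one_bad MC W hw1 hw2 x00 Kf T tt tb cb mh mh' hx hx' (good_ndiv gf)); [exact: Lf|exact: Rt].
apply: (both_bad MC W hw1 hw2 x00 Kf T tt tb mh mh' hx hx' (good_ndiv gf) (xb := x0)) => //.
- exact: Lf.
- exact: Rt.
by left.
Qed.

Lemma good_solved f : 0 <= w -> good f -> solved K.
Proof.
move=> w0 gf.
have [k [e [U tt cf]]] := optimal_line gf.
set F := fun x y => f x (y + (k * x + e)) in tt cf.
have gF : good F by apply: good_vshear.
have [k2 [e2 [U2 tb cb]]] := optimal_line (good_flip 0 0 gF).
have EG : (fun x y => flip 0 0 F x (y + (k2 * x + e2))) = flip (- k2) e2 F.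
  by apply/funext => x; apply/funext => y; rewrite /flip; congr F; ring.
rewrite EG in tb cb.
have T : in_trapezoid w (- k2) e2 F.
  have [_ SF _] := gF; move=> x y h; have [a1 a2] := SF _ _ h.
  have b1 := U _ _ h.
  have := U2 x (- y); rewrite /flip mul0r subrr sub0r opprK => /(_ h) b2.
  by clear -a1 a2 b1 b2; lia.
have [k0|k0] := leP k2 0.
  have es : - k2 = (absz k2)%:Z by clear -k0; lia.
  rewrite es in T tb cb; exact: (good_solved_s w0 gF T tt tb cf cb).
(* A bottom line of negative slope is turned into one of positive slope by reflection. *)
pose F' x y := F (w - x) y.
have EF : flip k2 (e2 + k2 * w) F' = fun x y => flip (- k2) e2 F (w - x) y.
  by apply/funext => x; apply/funext => y; rewrite /flip /F'; congr F; ring.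
have es : k2 = (absz k2)%:Z by clear -k0; lia.
have refl_tt G : top_touch G -> top_touch (fun x y => G (w - x) y).
  by case=> x h; exists (w - x); rewrite opprB addrC subrK.
have refl_c G : corners w x0 G -> corners w x0 (fun x y => G (w - x) y).
  move=> [[xa [ya [ha qa]]] [xb [yb [hb qb]]]]; split.
    by exists (w - xb), yb; rewrite opprB addrC subrK.
  by exists (w - xa), ya; have -> : w - (w - xa) = xa by ring.
apply: (@good_solved_s (absz k2) F' (e2 + k2 * w) w0 (good_refl gF)); rewrite -?es.
- by move=> x y /T; clear; lia.
- exact: refl_tt.
- by rewrite EF; apply: refl_tt.
- exact: refl_c.
by rewrite EF; apply: refl_c.
Qed.

End Minimal.

Theorem mutation_class_solved (V : zmodType) (K : (int -> int -> V) -> Prop) :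
  mutation_class K -> (exists f, K f) -> solved K.
Proof.
move=> MC ex.
have [w [W [f [Kf Sf]]]] := min_width_ex MC ex.
have [L [[F GF] minL]] := min_len_ex MC W (ex_intro _ f (conj Kf Sf)).
have [x0 [h1 h2 h3]] : exists x0 : int, [/\ 2 * x0 <= w%:Z, w%:Z <= 2 * x0 + 1 & 0 <= x0].
  by exists ((w./2)%:Z); split; lia.
by apply: (good_solved MC W minL h1 h2 h3 _ GF).
Qed.

(** * Integral separation in the plane and Newton polygons *)

Definition zero_comb (Z : seq (int * int)) := exists z1 z2 z3 (a b c : int),
  [/\ [/\ z1 \in Z, z2 \in Z & z3 \in Z], [/\ 0 <= a, 0 <= b & 0 <= c], 0 < a + b + c,
      a * z1.1 + b * z2.1 + c * z3.1 = 0 & a * z1.2 + b * z2.2 + c * z3.2 = 0].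

Lemma zero_comb_sub (Z Z' : seq (int * int)) : {subset Z <= Z'} -> zero_comb Z -> zero_comb Z'.
Proof.
move=> S [z1 [z2 [z3 [a [b [c [[h1 h2 h3] H1 H2 H3 H4]]]]]]].
by exists z1, z2, z3, a, b, c; split => //; split; apply: S.
Qed.

Lemma sign_perturb (Z : seq (int * int)) (d e : int * int -> int) :
  (forall z, z \in Z -> 0 < d z) -> exists M : int, forall z, z \in Z -> e z < M * d z.
Proof.
move=> H; exists (\sum_(z <- Z) `|e z| + 1) => z zZ.
have h : `|e z| <= \sum_(z <- Z) `|e z|.
  by rewrite (big_rem z) //= lerDl sumr_ge0.
set M := \sum_(z <- Z) `|e z| in h *.
have hd := H _ zZ.
apply: (@lt_le_trans _ _ (M + 1)); first by lia.
by rewrite ler_peMr //; lia.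
Qed.

(** Gordan's alternative in the plane. When the old separator fails on [z0], either [Z] lies
    strictly on one side of the line through [z0], and a form close to the normal of that line
    separates, or vectors on both sides balance [z0]. *)
Lemma zero_comb_or_sep (Z : seq (int * int)) :
  zero_comb Z \/ exists p q : int, forall z, z \in Z -> p * z.1 + q * z.2 < 0.
Proof.
elim: Z => [|z0 Z IH]; first by right; exists 0, 0.
case: IH => [C|[p [q H]]].
  by left; apply: zero_comb_sub C => z; rewrite inE => ->; rewrite orbT.
have [h0|h0] := ltP (p * z0.1 + q * z0.2) 0.
  by right; exists p, q => z; rewrite inE => /orP [/eqP ->|/H].
have [e0|n0] := eqVneq z0 (0, 0).
  left; exists z0, z0, z0, 1, 0, 0; rewrite e0 /= inE eqxx.
  by split => //; split.
pose d (z : int * int) := z0.1 * z.2 - z0.2 * z.1.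
have sq : 0 < z0.1 * z0.1 + z0.2 * z0.2.
  have : z0.1 != 0 \/ z0.2 != 0.
    apply: contrapT => hh; move/eqP: n0; apply; rewrite [z0]surjective_pairing.
    congr pair; apply/eqP/negPn/negP => h; apply: hh; auto.
  have a1 := sqr_ge0 z0.1; have a2 := sqr_ge0 z0.2.
  rewrite -!expr2; case => h; move: (h); rewrite -sqrf_eq0; lia.
have [P|nP] := pselect (forall z, z \in Z -> 0 < d z).
  right; have [M hM] := sign_perturb (fun z => - (z0.1 * z.1 + z0.2 * z.2)) P.
  exists (M * z0.2 - z0.1), (- M * z0.1 - z0.2) => z; rewrite inE => /orP [/eqP ->|/hM].
    rewrite (_ : _ + _ = - (z0.1 * z0.1 + z0.2 * z0.2)); last by ring.
    by rewrite oppr_lt0.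
  rewrite -subr_lt0 (_ : _ - _ = (M * z0.2 - z0.1) * z.1 + (- M * z0.1 - z0.2) * z.2) //.
  by rewrite /d; ring.
have [P'|nP'] := pselect (forall z, z \in Z -> 0 < - d z).
  right; have [M hM] := sign_perturb (fun z => - (z0.1 * z.1 + z0.2 * z.2)) P'.
  exists (- M * z0.2 - z0.1), (M * z0.1 - z0.2) => z; rewrite inE => /orP [/eqP ->|/hM].
    rewrite (_ : _ + _ = - (z0.1 * z0.1 + z0.2 * z0.2)); last by ring.
    by rewrite oppr_lt0.
  rewrite -subr_lt0 (_ : _ - _ = (- M * z0.2 - z0.1) * z.1 + (M * z0.1 - z0.2) * z.2) //.
  by rewrite /d; ring.
have [z [zZ dz]] : exists z, z \in Z /\ d z <= 0.
  apply: contrapT => hh; apply: nP => z zZ; rewrite ltNge; apply/negP => hz; apply: hh.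
  by exists z.
have [z' [zZ' dz']] : exists z, z \in Z /\ 0 <= d z.
  apply: contrapT => hh; apply: nP' => z1 zZ1; rewrite oppr_gt0 ltNge; apply/negP => hz; apply: hh.
  by exists z1.
have hz := H _ zZ; have hz' := H _ zZ'.
set uz := p * z.1 + q * z.2 in hz; set uz' := p * z'.1 + q * z'.2 in hz'.
set u0 := p * z0.1 + q * z0.2 in h0.
(* [D], [d z'], [- d z] are the coefficients of the linear relation between [z0], [z] and [z']. *)
pose D := z'.1 * z.2 - z'.2 * z.1.
have E : D * u0 = d z * uz' - d z' * uz by rewrite /D /d /u0 /uz /uz'; ring.
have in0 : z0 \in z0 :: Z by rewrite inE eqxx.
have inz : z \in z0 :: Z by rewrite inE zZ orbT.
have inz' : z' \in z0 :: Z by rewrite inE zZ' orbT.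
have [u00|u0p] := eqVneq u0 0.
  (* Here [z0] spans the zero line of the separator, and [Z] lies strictly on one side of it, so [d]
     cannot change sign on [Z]. *)
  exfalso.
  pose e := z0.1 * q - z0.2 * p.
  have E1 : d z * (p * p + q * q) = uz * e + (p * z.2 - q * z.1) * u0 by rewrite /d /uz /e /u0; ring.
  have E2 : d z' * (p * p + q * q) = uz' * e + (p * z'.2 - q * z'.1) * u0 by rewrite /d /uz' /e /u0; ring.
  have pq : 0 <= p * p + q * q by rewrite -!expr2 addr_ge0 ?sqr_ge0.
  have E3 : (z0.1 * z0.1 + z0.2 * z0.2) * (p * p + q * q) = u0 * u0 + e * e by rewrite /u0 /e; ring.
  rewrite u00 !mulr0 !addr0 ?add0r in E1 E2 E3.
  have e1 : 0 <= e by rewrite -(nmulr_rle0 _ hz) -E1 mulr_le0_ge0.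
  have e2 : e <= 0 by rewrite -(nmulr_rge0 _ hz') -E2 mulr_ge0.
  have ee : e = 0 by lia.
  move: E3; rewrite ee mulr0 => /eqP; rewrite mulf_eq0 (gt_eqF sq) /= -!expr2.
  rewrite paddr_eq0 ?sqr_ge0 // !sqrf_eq0 => /andP [/eqP p0 /eqP q0].
  by move: hz; rewrite /uz p0 q0 !mul0r addr0 ltxx.
have u0pos : 0 < u0 by rewrite lt_neqAle eq_sym u0p.
have D0 : 0 <= D.
  rewrite -(pmulr_lge0 _ u0pos) E subr_ge0; apply: (@le_trans _ _ 0).
    by rewrite mulr_ge0_le0 // ltW.
  by rewrite mulr_le0 // ltW.
left.
have [dd|dd] := eqVneq (d z) 0.
  exists z0, z, z, (- uz), u0, 0; split => //; first by split => //; rewrite ?oppr_ge0 ltW.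
  - by rewrite addr0 addr_gt0 // oppr_gt0.
  - rewrite (_ : _ + _ = - q * d z); first by rewrite dd mulr0.
    by rewrite /uz /u0 /d; ring.
  - rewrite (_ : _ + _ = p * d z); first by rewrite dd mulr0.
    by rewrite /uz /u0 /d; ring.
exists z0, z, z', D, (d z'), (- d z); split => //; first by split => //; rewrite oppr_ge0.
- by move: (d z) (d z') D D0 dz dz' dd {E} => A B C; clear; lia.
- by rewrite /D /d; ring.
- by rewrite /D /d; ring.
Qed.

Section Conv.
Variable R : realType.

(** Sums run over a list with repetitions, so a unit weight at [n] is divided by its number of
    occurrences. *)
Lemma sum_indicator (S : seq latN) (n : latN) (F : latN -> R) : n \in S ->
  \sum_(s <- S) (s == n)%:R / (count_mem n S)%:R * F s = F n.
Proof.
move=> nS.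
have c0 : (count_mem n S)%:R != 0 :> R by rewrite pnatr_eq0 -lt0n -has_count has_pred1.
rewrite (eq_bigr (fun s => (s == n)%:R * (F n / (count_mem n S)%:R))); last first.
  by move=> s _; have [->|_] := eqVneq s n; rewrite ?mul0r // !mul1r mulrC.
rewrite -mulr_suml.
have -> : \sum_(s <- S) (s == n)%:R = (count_mem n S)%:R :> R.
  by rewrite -natr_sum -sum1_count [in RHS]big_mkcond; congr (_%:R); apply: eq_bigr => s _ /=; case: eqP.
by rewrite mulrCA mulfV // mulr1.
Qed.

Lemma in_conv_mem (S : seq latN) (n : latN) : n \in S -> in_conv S (toR R n).
Proof.
move=> nS; exists (fun s => (s == n)%:R / (count_mem n S)%:R); split.
  by move=> s; rewrite divr_ge0.
have := sum_indicator (fun _ => 1) nS; rewrite (eq_bigr _ (fun _ _ => mulr1 _)) => ->.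
by rewrite !(sum_indicator _ nS).
Qed.

Lemma in_conv_comb (S : seq latN) (v : latN) :
  zero_comb [seq (n.1 - v.1, n.2 - v.2) | n <- S] -> in_conv S (toR R v).
Proof.
move=> [z1 [z2 [z3 [a [b [c [[/mapP [n1 h1 ->] /mapP [n2 h2 ->] /mapP [n3 h3 ->]] [a0 b0 c0] T E1 E2]]]]]]].
pose t : R := (a + b + c)%:~R.
have t0 : 0 < t by rewrite ltr0z.
have tn : t != 0 by rewrite gt_eqF.
pose W (n : latN) (s : latN) : R := (s == n)%:R / (count_mem n S)%:R.
have sumW (F : latN -> R) :
    \sum_(s <- S) (a%:~R / t * W n1 s + b%:~R / t * W n2 s + c%:~R / t * W n3 s) * F s
    = (a%:~R * F n1 + b%:~R * F n2 + c%:~R * F n3) / t.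
  rewrite (eq_bigr (fun s => a%:~R / t * (W n1 s * F s) + b%:~R / t * (W n2 s * F s)
     + c%:~R / t * (W n3 s * F s))); last by move=> s _; ring.
  rewrite !big_split /= -!mulr_sumr !sum_indicator //. by rewrite !mulrDl; congr (_ + _ + _); rewrite mulrAC.
exists (fun s => a%:~R / t * W n1 s + b%:~R / t * W n2 s + c%:~R / t * W n3 s).
have coord (p : latN -> int) : a * (p n1 - p v) + b * (p n2 - p v) + c * (p n3 - p v) = 0 ->
   (p v)%:~R = (a%:~R * (p n1)%:~R + b%:~R * (p n2)%:~R + c%:~R * (p n3)%:~R) / t :> R.
  move=> E; apply: (mulIf tn); rewrite divfK // /t -!intrM -!intrD; congr (_%:~R).
  by apply/eqP; rewrite eq_sym -subr_eq0 -[X in _ == X]E; apply/eqP; ring.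
split; last split; last split.
- by move=> s; rewrite !addr_ge0 // mulr_ge0 // ?divr_ge0 ?ler0z // ltW.
- have := sumW (fun _ => 1); rewrite (eq_bigr _ (fun _ _ => mulr1 _)) => ->.
  by rewrite !mulr1 -!intrD divff.
- by rewrite sumW; apply: (coord (fun n => n.1)).
- by rewrite sumW; apply: (coord (fun n => n.2)).
Qed.

Lemma in_conv_sep (S : seq latN) (v : latN) :
  (forall p q : int, exists2 n, n \in S & p * v.1 + q * v.2 <= p * n.1 + q * n.2) ->
  in_conv S (toR R v).
Proof.
move=> H; apply: in_conv_comb.
case: (zero_comb_or_sep [seq (n.1 - v.1, n.2 - v.2) | n <- S]) => // -[p [q Hpq]].
exfalso; have [n nS hn] := H p q.
have := Hpq _ (map_f (fun n : latN => (n.1 - v.1, n.2 - v.2)) nS).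
rewrite /= ltNge => /negP; apply; rewrite !mulrBr addrACA -opprD subr_ge0 //.
Qed.

Lemma unimodular_gcdz (p q : int) : unimodular p q <-> gcdz p q = 1%N.
Proof.
split=> [[u [v e]]|e].
  have : (gcdz p q %| u * p + v * q)%Z by rewrite rpredD // dvdz_mull // ?dvdz_gcdl ?dvdz_gcdr.
  by rewrite e dvdz1 => /eqP; rewrite /gcdz absz_nat => ->.
have [u [v E]] := Bezoutz p q.
by exists u, v; rewrite E e.
Qed.

Lemma segment_lattice (a b n : latN) : gcdz (b.1 - a.1) (b.2 - a.2) = 1%N ->
  in_conv [:: a; b] (toR R n) -> n = a \/ n = b.
Proof.
move=> /unimodular_gcdz [u [v e]] [w [w0 [w1 [/= x1 x2]]]].
rewrite !big_cons !big_nil !addr0 in w1 x1 x2.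
have wa : w a = 1 - w b by rewrite -w1 addrK.
rewrite wa in x1 x2.
have y1 : (n.1 - a.1)%:~R = w b * (b.1 - a.1)%:~R by rewrite !intrB x1; ring.
have y2 : (n.2 - a.2)%:~R = w b * (b.2 - a.2)%:~R by rewrite !intrB x2; ring.
(* A Bezout form for the primitive direction reads off the parameter, so it is an integer between
   [0] and [1]. *)
have wb : w b = (u * (n.1 - a.1) + v * (n.2 - a.2))%:~R.
  rewrite intrD !intrM y1 y2.
  transitivity (w b * (u * (b.1 - a.1) + v * (b.2 - a.2))%:~R); first by rewrite e mulr1.
  by rewrite !intrD !intrM !intrD; ring.
set k := u * _ + _ in wb.
have k0 : 0 <= k by rewrite -(ler0z R) -wb.
have k1 : k <= 1 by rewrite -(ler_int R) -wb -subr_ge0 -wa.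
rewrite wb -!intrM in y1 y2.
have {}y1 := intr_inj y1; have {}y2 := intr_inj y2.
have [k_0|k_1] : k = 0 \/ k = 1 by lia.
  by left; rewrite [n]surjective_pairing [a]surjective_pairing; congr pair; move: y1 y2; rewrite k_0; lia.
by right; rewrite [n]surjective_pairing [b]surjective_pairing; congr pair; move: y1 y2; rewrite k_1; lia.
Qed.

End Conv.

(** * Laurent polynomials as coefficient arrays *)

Section Coef.
Variable R : realType.
Local Notation C := (complex R).
Implicit Types f g h l : laurent R.

Lemma coef_lmul f h (n : latN) :
  coef (lmul f h) n = \sum_(p <- f) p.2 * coef h (n.1 - p.1.1, n.2 - p.1.2).
Proof.
rewrite /coef /lmul big_mkcond big_allpairs_dep; apply: eq_bigr => p _.
rewrite mulr_sumr -big_mkcond; apply: eq_bigl => q /=.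
rewrite [n in RHS]surjective_pairing /addN; apply/eqP/eqP => [<- /=|->].
  by rewrite [q.1]surjective_pairing /= ![_ + _ - _]addrAC !subrr !add0r.
by case: n => n1 n2 /=; congr pair; ring.
Qed.

Lemma coef_lmulC f h (n : latN) : coef (lmul f h) n = coef (lmul h f) n.
Proof.
have E (f' h' : laurent R) : coef (lmul f' h') n =
    \sum_(p <- f') \sum_(q <- h') (if addN p.1 q.1 == n then p.2 * q.2 else 0).
  by rewrite /coef /lmul big_mkcond big_allpairs_dep.
rewrite !E exchange_big; apply: eq_bigr => p _; apply: eq_bigr => q _.
by rewrite mulrC /addN addrC [X in (_, X)]addrC.
Qed.

Lemma coef_lmulA f g h (n : latN) : coef (lmul (lmul f g) h) n = coef (lmul f (lmul g h)) n.
Proof.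
rewrite !coef_lmul {1}/lmul big_allpairs_dep; apply: eq_bigr => p _.
rewrite coef_lmul mulr_sumr; apply: eq_bigr => q _ /=.
rewrite mulrA; congr (_ * coef h (_, _)); ring.
Qed.

Lemma sum_delta (I : eqType) (s : seq I) (x : I) (F : I -> C) : uniq s -> x \in s ->
  \sum_(i <- s) (i == x)%:R * F i = F x.
Proof.
move=> us xs; rewrite (bigD1_seq x) //= eqxx mul1r big1 ?addr0 // => i /negbTE ->.
by rewrite mul0r.
Qed.

Lemma sum_coef (f : laurent R) (F : latN -> C) :
  \sum_(p <- f) p.2 * F p.1 = \sum_(n <- undup [seq p.1 | p <- f]) coef f n * F n.
Proof.
transitivity (\sum_(p <- f) \sum_(n <- undup [seq p.1 | p <- f]) (n == p.1)%:R * (p.2 * F n)).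
  rewrite big_seq [RHS]big_seq; apply: eq_bigr => p pf.
  by rewrite sum_delta ?undup_uniq // mem_undup map_f.
rewrite exchange_big; apply: eq_bigr => n _.
rewrite /coef mulr_suml [RHS]big_mkcond; apply: eq_bigr => p _.
by rewrite eq_sym; case: eqP => _; rewrite ?mul1r ?mul0r.
Qed.

Lemma coef_lmul_binomial g h (a b n : latN) : a != b ->
  (forall n, coef g n = (n == a)%:R + (n == b)%:R) ->
  coef (lmul g h) n = coef h (n.1 - a.1, n.2 - a.2) + coef h (n.1 - b.1, n.2 - b.2).
Proof.
move=> ab E; rewrite coef_lmul (sum_coef g (fun p => coef h (n.1 - p.1, n.2 - p.2))).
have mem (c : latN) : coef g c != 0 -> c \in undup [seq p.1 | p <- g].
  move=> cn; rewrite mem_undup; apply: contraNT cn => nc; apply/eqP.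
  rewrite /coef big_seq_cond big1 // => p /andP [pg /eqP pc].
  by case/negP: nc; rewrite -pc map_f.
have aS : a \in undup [seq p.1 | p <- g] by apply: mem; rewrite E eqxx (negbTE ab) addr0 oner_eq0.
have bS : b \in undup [seq p.1 | p <- g].
  by apply: mem; rewrite E eqxx [b == a]eq_sym (negbTE ab) add0r oner_eq0.
under eq_bigr => m _ do rewrite E mulrDl.
by rewrite big_split /= !sum_delta ?undup_uniq.
Qed.

Definition coefA (l : laurent R) : int -> int -> C := fun x y => coef l (x, y).

Lemma coef_lone h (n : latN) : coef (lmul (lone R) h) n = coef h n.
Proof. by rewrite coef_lmul big_cons big_nil /= mul1r addr0 !subr0 -surjective_pairing. Qed.

(** From [g = z^a + z^b] one gets [g^i = z^(i a) (1 + z^(b - a))^i], whence the shift. *)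
Lemma coef_lpow_lmul g h (a b : latN) (i : nat) (x y : int) : a != b ->
  (forall n, coef g n = (n == a)%:R + (n == b)%:R) ->
  coef (lmul (lpow g i) h) (x, y) =
  mulpn (b.1 - a.1) (b.2 - a.2) i (coefA h) (x - i%:Z * a.1) (y - i%:Z * a.2).
Proof.
move=> ab E; elim: i x y => [|i IH] x y.
  by rewrite coef_lone !mul0r !subr0.
rewrite /lpow iterS -/(lpow g i) coef_lmulA (coef_lmul_binomial _ _ ab E) !IH mulpnS.
by congr (_ + _); congr (mulpn _ _ _ _ _ _); rewrite /= intS; ring.
Qed.

Lemma coef_restr (m : latMt) f (i : int) (n : latN) :
  coef (restr m f i) n = if phi m n == i then coef f n else 0.
Proof.
rewrite /coef /restr big_filter_cond; case: ifP => h.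
  by apply: eq_bigl => p; rewrite andbC; case: eqP => // ->; rewrite h.
rewrite big1 // => p /andP [/eqP h1 /eqP h2].
by move: h; rewrite -h2 h1 eqxx.
Qed.

Lemma coef_mem (l : laurent R) (n : latN) : coef l n != 0 -> n \in [seq p.1 | p <- l].
Proof.
move=> cn; apply: contraNT cn => nc; apply/eqP.
rewrite /coef big_seq_cond big1 // => p /andP [pg /eqP pc].
by case/negP: nc; rewrite -pc map_f.
Qed.

Lemma coefA_fin (l : laurent R) : finite_supp (coefA l).
Proof.
have H (s : seq latN) : exists B : int, forall n, n \in s -> `|n.1| <= B /\ `|n.2| <= B.
  elim: s => [|n s [B hB]]; first by exists 0.
  exists (`|B| + `|n.1| + `|n.2|) => m; rewrite inE => /orP [/eqP ->|/hB [h1 h2]].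
    by move: (n.1) (n.2) => u v; clear; lia.
  by move: (n.1) (n.2) (m.1) (m.2) h1 h2 => u v u' v'; clear; lia.
have [B hB] := H [seq p.1 | p <- l].
by exists B => x y /coef_mem /hB /=; lia.
Qed.

Lemma laurent_of_fin (G : int -> int -> C) : finite_supp G -> exists l : laurent R, forall n, coef l n = G n.1 n.2.
Proof.
move=> [B hB].
pose r := [seq i%:Z - `|B| | i <- iota 0 (absz B + absz B + 1)].
pose s := undup [seq (x, y) | x <- r, y <- r].
have mem x : - `|B| <= x -> x <= `|B| -> x \in r.
  move=> h1 h2; apply/mapP; exists (absz (x + `|B|)%R); last by lia.
  by rewrite mem_iota; lia.
exists [seq (n, G n.1 n.2) | n <- s] => n; rewrite /coef big_map.
have E : \sum_(j <- s | (j, G j.1 j.2).1 == n) (j, G j.1 j.2).2 = \sum_(j <- s) (j == n)%:R * G j.1 j.2.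
  by rewrite big_mkcond; apply: eq_bigr => j _ /=; case: eqP => _; rewrite ?mul1r ?mul0r.
rewrite E; have [e|nz] := eqVneq (G n.1 n.2) 0.
  by rewrite e big1 // => j _; case: eqP => [->|_]; rewrite ?e ?mulr0 ?mul0r.
rewrite sum_delta ?undup_uniq // mem_undup; apply/allpairsP; exists n.
have [b1 b2] : n.1 \in r /\ n.2 \in r.
  by move: (n.1) (n.2) (hB _ _ nz) => u v h; split; apply: mem; lia.
by split => //; rewrite -surjective_pairing.
Qed.

End Coef.

(** * Mutation steps and mutability in terms of arrays *)

Section Interface.
Variable R : realType.
Local Notation C := (complex R).
Implicit Types f g h l : laurent R.

Definition binomial_at (e : latN) : laurent R := [:: ((0, 0), 1); (e, 1)].

Lemma unimodular_neq (a b : latN) : unimodular (b.1 - a.1) (b.2 - a.2) -> a != b.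
Proof.
move=> H; apply/eqP => e; move: H; rewrite e !subrr => -[u [v]].
by rewrite !mulr0 addr0.
Qed.

Lemma coef_binomial (e n : latN) : coef (binomial_at e) n = (n == (0, 0))%:R + (n == e)%:R.
Proof.
rewrite /coef big_mkcond !big_cons big_nil /= addr0 !(eq_sym n).
by do 2 case: eqP => _.
Qed.

Lemma suppl_binomial (e : latN) : unimodular e.1 e.2 -> suppl (binomial_at e) = [:: (0, 0); e].
Proof.
move=> pe; have ne : ((0, 0) : latN) != e by apply: unimodular_neq; rewrite !subr0.
rewrite /suppl /= !coef_binomial !eqxx (negbTE ne) [e == _]eq_sym (negbTE ne) addr0 add0r.
by rewrite oner_eq0.
Qed.

Lemma admissible_binomial (m : latMt) (e : latN) : unimodular e.1 e.2 -> pairing m.1 e = 0 ->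
  admissible m (binomial_at e).
Proof.
move=> pe me.
have ne : ((0, 0) : latN) != e by apply: unimodular_neq; rewrite !subr0.
have ge : gcdz (e.1 - ((0, 0) : latN).1) (e.2 - ((0, 0) : latN).2) = 1%N.
  by rewrite /= !subr0; apply/unimodular_gcdz.
split; [|split].
- move=> n [hn _].
  have [->|->] : n = (0, 0) \/ n = e.
    by apply: (segment_lattice ge (R := R)); rewrite -suppl_binomial.
  + by rewrite coef_binomial eqxx (negbTE ne) addr0.
  by rewrite coef_binomial eqxx [e == _]eq_sym (negbTE ne) add0r.
- move=> n; rewrite coef_binomial; have [->|_] := eqVneq n (0, 0).
    by rewrite /pairing !mulr0 addr0.
  by have [->|_] := eqVneq n e; rewrite ?me // addr0 eqxx.
exists (0, 0), e; split => // x; by rewrite /newton suppl_binomial.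
Qed.

Lemma mut_step_of_murel l (G : int -> int -> C) (p q c a b : int) : finite_supp G -> unimodular a b ->
  p * a + q * b = 0 -> (p != 0) || (q != 0) -> mutation_rel (coefA l) G p q c a b ->
  exists l', mut_step l l' /\ forall n, coef l' n = G n.1 n.2.
Proof.
move=> fG pab ab pq Rel.
have [l' El'] := laurent_of_fin fG.
exists l'; split => //.
pose m : latMt := ((p, q), c); pose g := binomial_at (a, b).
have ne : ((0, 0) : latN) != (a, b) by apply: unimodular_neq; rewrite /= !subr0.
have Ecoef (i : nat) h (x y : int) : coef (lmul (lpow g i) h) (x, y) = mulpn a b i (coefA h) x y.
  by rewrite (coef_lpow_lmul _ _ _ _ ne (coef_binomial _)) /= !mulr0 !subr0.
have row (j : int) (x y : int) : phi m (x - a * j, y - b * j) = phi m (x, y).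
  rewrite /phi /pairing /=; congr (_ + _).
  have -> : p * (x - a * j) + q * (y - b * j) = p * x + q * y - (p * a + q * b) * j by ring.
  by rewrite ab mul0r subr0.
have rr (h : laurent R) (i : int) (k : nat) (x y : int) :
    mulpn a b k (coefA (restr m h i)) x y = if phi m (x, y) == i then mulpn a b k (coefA h) x y else 0.
  case: eqP => e.
    by apply: mulpn_ext => j _; rewrite /coefA coef_restr row e eqxx.
  apply: mulpn_eq0 => j _; rewrite /coefA coef_restr row; by case: eqP.
have ElG (k : nat) (x y : int) : mulpn a b k (coefA l') x y = mulpn a b k G x y.
  by apply: mulpn_ext => j _; rewrite /coefA El'.
exists m, g; split.
  move=> k [p0 q0 _]; by move: pq; rewrite p0 q0.
split; first exact: admissible_binomial.
pose H (i : int) : laurent R := match i with Posz k => restr m l' k%:Z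
   | Negz k => lmul (restr m l (Negz k)) (lpow g k.+1) end.
exists H.
split; [|split] => //.
  move=> i [x y]; rewrite Ecoef rr coef_restr; case: eqP => // e.
  by rewrite ElG; apply (Rel x y i).
move=> [x y].
have HE (i : int) : coef (H i) (x, y) = if phi m (x, y) == i then G x y else 0.
  case: i => k; rewrite /H; first by rewrite coef_restr El'.
  rewrite coef_lmulC Ecoef rr; case: eqP => // e.
  by apply/esym; apply (Rel x y k.+1); rewrite -NegzE.
under eq_bigr => i _ do rewrite HE.
rewrite El' /=; have [G0|G0] := eqVneq (G x y) 0.
  by rewrite G0 big1 // => i _; case: eqP.
rewrite (eq_bigr (fun i => (i == phi m (x, y))%:R * G x y)); last first.
  by move=> i _; rewrite eq_sym; case: eqP => _; rewrite ?mul1r ?mul0r.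
rewrite (@sum_delta R _ _ (phi m (x, y)) (fun _ => G x y)) ?undup_uniq // mem_undup.
(* The sum runs over heights occurring in [l]; a nonzero coefficient of [G] lies in a row that [l]
   meets. *)
have [[s fs] _] := mutation_rel_supp fG (unimodular_neq0 pab) ab Rel G0.
have := coef_mem fs; case/mapP => r rl er.
by apply/mapP; exists r => //; rewrite -er row.
Qed.

Lemma in_conv_swap (a b : latN) (x : R * R) : in_conv [:: a; b] x -> in_conv [:: b; a] x.
Proof.
case=> w [w0]; rewrite !big_cons !big_nil !addr0 => -[w1 [x1 x2]].
exists w; rewrite !big_cons !big_nil !addr0; split => //.
by rewrite addrC x1 x2 w1; split => //; split; exact: addrC.
Qed.

Lemma vertex_left g (a b : latN) : unimodular (b.1 - a.1) (b.2 - a.2) ->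
  (forall x, newton g x <-> in_conv [:: a; b] x) -> vertex g (toR R a).
Proof.
move=> pab H; split; first by apply/H/in_conv_mem; rewrite inE eqxx.
move=> [A [B [t [/H HA [/H HB [AB [/andP [t0 t1] [e1 e2]]]]]]]].
have par X : in_conv [:: a; b] X -> exists s : R, [/\ 0 <= s,
    X.1 = a.1%:~R + s * (b.1 - a.1)%:~R & X.2 = a.2%:~R + s * (b.2 - a.2)%:~R].
  case=> w [w0]; rewrite !big_cons !big_nil !addr0 => -[w1 [x1 x2]].
  have wa : w a = 1 - w b by rewrite -w1 addrK.
  by exists (w b); split => //; rewrite ?x1 ?x2 wa intrB; ring.
have [s [s0 A1 A2]] := par _ HA; have [r [r0 B1 B2]] := par _ HB.
pose k := t * s + (1 - t) * r.
have k1 : k * (b.1 - a.1)%:~R = 0.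
  by move: e1; rewrite /= A1 B1 /k => e1; apply: (addrI a.1%:~R); rewrite addr0 [RHS]e1; ring.
have k2 : k * (b.2 - a.2)%:~R = 0.
  by move: e2; rewrite /= A2 B2 /k => e2; apply: (addrI a.2%:~R); rewrite addr0 [RHS]e2; ring.
have k0 : k = 0.
  case: pab => u [v e]; rewrite -[k]mulr1.
  have -> : 1 = (u * (b.1 - a.1) + v * (b.2 - a.2))%:~R :> R by rewrite e.
  by rewrite intrD !intrM mulrDr !mulrA ![k * _]mulrC -!mulrA k1 k2 !mulr0 addr0.
have t1' : 0 < 1 - t by rewrite subr_gt0.
have : t * s = 0 /\ (1 - t) * r = 0.
  have p1 : 0 <= t * s by rewrite mulr_ge0 // ltW.
  have p2 : 0 <= (1 - t) * r by rewrite mulr_ge0 // ltW.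
  move: k0; rewrite /k => /eqP; rewrite (paddr_eq0 p1 p2) => /andP [/eqP h1 /eqP h2].
  by [].
move=> [/eqP]; rewrite mulf_eq0 (gt_eqF t0) /= => /eqP s00 /eqP.
rewrite mulf_eq0 (gt_eqF t1') /= => /eqP r00.
by apply: AB; rewrite [A]surjective_pairing [B]surjective_pairing A1 A2 B1 B2 s00 r00.
Qed.

(** A segment of length one has no lattice points besides its ends, and normalization fixes both
    coefficients. *)
Lemma admissible_coef (m : latMt) g : admissible m g -> exists a b : latN,
  [/\ unimodular (b.1 - a.1) (b.2 - a.2), forall n, coef g n = (n == a)%:R + (n == b)%:R,
      pairing m.1 a = 0 & pairing m.1 b = 0].
Proof.
move=> [N [P [a [b [/[dup] gab /unimodular_gcdz pab H]]]]].
have ab := unimodular_neq pab.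
have ca : coef g a = 1 by apply: N; apply: vertex_left pab H.
have cb : coef g b = 1.
  apply: N; apply: (@vertex_left _ b a).
    by case: pab => u [v e]; exists (- u), (- v); rewrite -e; ring.
  by move=> x; rewrite H; split; exact: in_conv_swap.
have cn n : coef g n != 0 -> n = a \/ n = b.
  move=> h; apply: (segment_lattice gab (R := R)); apply/H; apply: in_conv_mem.
  have /mapP [r rg er] := coef_mem h; rewrite /suppl er; apply: map_f.
  by rewrite mem_filter rg andbT -er.
exists a, b; split => //; last first.
- by apply: P; rewrite cb oner_eq0.
- by apply: P; rewrite ca oner_eq0.
move=> n; have [->|na] := eqVneq n a; first by rewrite (negbTE ab) addr0.
have [->|nb] := eqVneq n b; first by rewrite add0r.
rewrite addr0; apply/eqP/negPn/negP => /cn [] e; [move: na|move: nb]; by rewrite e eqxx.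
Qed.

Lemma mutable_has_mult_dir (m : latMt) l : m_mutable m l -> exists e1 e2 : int,
  [/\ unimodular e1 e2, m.1.1 * e1 + m.1.2 * e2 = 0, (m.1.1 != 0) || (m.1.2 != 0) &
      has_mult_dir (coefA l) m.1.1 m.1.2 m.2 e1 e2].
Proof.
move=> [nR [g [adm mu]]].
have [a [b [pab E ma mb]]] := admissible_coef adm.
have ab := unimodular_neq pab.
exists (b.1 - a.1), (b.2 - a.2).
have perp : m.1.1 * (b.1 - a.1) + m.1.2 * (b.2 - a.2) = 0.
  by move: ma mb; rewrite /pairing => ma mb; rewrite !mulrBr addrACA -opprD mb ma subrr.
split => //.
  apply/negPn/negP; rewrite negb_or !negbK => /andP [/eqP h1 /eqP h2].
  by apply: (nR m.2); rewrite [LHS]surjective_pairing; congr pair; rewrite [LHS]surjective_pairing h1 h2.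
have [h hE] := choice mu.
have [B hB] := coefA_fin l.
(* Bounds [phi_m] on the support of [l]; the array glued from one quotient per height is cut off at
   [M] to stay finite. *)
pose M : nat := absz ((`|m.1.1| + `|m.1.2|) * `|B| + `|m.2|)%R.
pose ph (x y : int) := m.1.1 * x + m.1.2 * y + m.2.
have big x y : M%:Z < ph x y -> coef l (x, y) = 0.
  move=> hM; apply/eqP/negPn/negP => /hB hb; move: hM; rewrite ltNge => /negP; apply.
  rewrite /M gez0_abs; last by rewrite addr_ge0 // mulr_ge0 // addr_ge0.
  rewrite /ph mulrDl; apply: lerD; last exact: ler_norm.
  by apply: lerD; apply: le_trans (ler_norm _) _; rewrite normrM ler_wpM2l //; clear -hb; lia.
pose G (x y : int) : C := if (0 <= ph x y) && (ph x y <= M%:Z)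
  then coef (h (absz (ph x y))) (x - (absz (ph x y))%:Z * a.1, y - (absz (ph x y))%:Z * a.2) else 0.
exists G.
  have fb (k : nat) : exists B : int, forall i : nat, (i <= k)%N -> forall x y,
      coef (h i) (x - i%:Z * a.1, y - i%:Z * a.2) != 0 -> `|x| <= B /\ `|y| <= B.
    elim: k => [|k [D hD]].
      have [D hD] := coefA_fin (h 0%N).
      by exists D => i; rewrite leqn0 => /eqP -> x y; rewrite !mul0r !subr0 => /hD; clear; lia.
    have [D' hD'] := coefA_fin (h k.+1).
    exists (`|D| + `|D'| + `|k.+1%:Z * a.1| + `|k.+1%:Z * a.2|) => i.
    rewrite leq_eqVlt => /orP [/eqP -> x y|ik x y /(hD _ ik)]; last by clear; lia.
    by move/hD'; move: (k.+1%:Z * a.1) (k.+1%:Z * a.2); clear; lia.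
  have [D hD] := fb M.
  exists D => x y; rewrite /G; case: ifP; last by rewrite eqxx.
  move=> /andP [h1 h2] h3; have := hD (absz (ph x y)) _ x y h3.
  by move=> /(_ ltac:(clear -h1 h2; lia)); clear; lia.
move=> x y i e.
have row (j : int) : ph (x - (b.1 - a.1) * j) (y - (b.2 - a.2) * j) = ph x y.
  rewrite /ph; have -> : m.1.1 * (x - (b.1 - a.1) * j) + m.1.2 * (y - (b.2 - a.2) * j) =
    m.1.1 * x + m.1.2 * y - (m.1.1 * (b.1 - a.1) + m.1.2 * (b.2 - a.2)) * j by ring.
  by rewrite perp mul0r subr0.
have [hM|hM] := leP (ph x y) M%:Z; last first.
  rewrite /coefA big // mulpn_eq0 // => j _; rewrite /G row.
  by rewrite [ph x y <= _]leNgt hM andbF.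
have := hE i.+1 (x, y); rewrite coef_restr.
have -> : phi m (x, y) == i.+1%:Z by apply/eqP; rewrite -e.
rewrite /coefA => ->; rewrite (coef_lpow_lmul _ _ _ _ ab E).
have tr k X Y : mulpn (b.1 - a.1) (b.2 - a.2) k (coefA (h i.+1)) (X - i.+1%:Z * a.1) (Y - i.+1%:Z * a.2)
  = mulpn (b.1 - a.1) (b.2 - a.2) k (fun X Y => coef (h i.+1) (X - i.+1%:Z * a.1, Y - i.+1%:Z * a.2)) X Y.
  elim: k X Y => // k IH X Y; rewrite !mulpnS -!IH; congr (_ + mulpn _ _ _ _ _ _); ring.
rewrite tr; apply: mulpn_ext => j _.
have eph : ph x y = i.+1%:Z by rewrite -e.
have h0 : 0 <= ph x y by rewrite eph.
by rewrite /G row h0 hM eph.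
Qed.

End Interface.

(** * The mutation orbit of a Laurent polynomial and the conclusion *)

Section Final.
Variable R : realType.
Local Notation C := (complex R).

Lemma mut_equiv_rcons (f l l' : laurent R) : mut_equiv f l -> mut_step l l' -> mut_equiv f l'.
Proof.
elim=> {f l} [f|f f1 l s _ IH] st; last exact: mut_trans s (IH st).
exact: mut_trans st (mut_refl _).
Qed.

(* Working up to affine [GL_2(Z)] lets every mutation be put in standard position. *)
Definition mut_orbit (f0 : laurent R) (F : int -> int -> C) :=
  exists l (a b c d e e' : int), [/\ mut_equiv f0 l, exists n, coef l n != 0,
    a * d - b * c = 1 \/ a * d - b * c = -1 & F = aff a b c d e e' (coefA l)].

Lemma aff_aff (a b c d e e' a1 b1 c1 d1 e1 e1' : int) (F : int -> int -> C) :
  aff a1 b1 c1 d1 e1 e1' (aff a b c d e e' F) =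
  aff (a * a1 + b * c1) (a * b1 + b * d1) (c * a1 + d * c1) (c * b1 + d * d1)
      (a * e1 + b * e1' + e) (c * e1 + d * e1' + e') F.
Proof. by apply/funext => x; apply/funext => y; rewrite /aff; congr F; ring. Qed.

Lemma aff_id (F : int -> int -> C) : aff 1 0 0 1 0 0 F = F.
Proof. by apply/funext => x; apply/funext => y; rewrite /aff; congr F; ring. Qed.

Lemma aff_inv (a b c d e e' : int) : a * d - b * c = 1 \/ a * d - b * c = -1 ->
  exists a1 b1 c1 d1 e1 e1' : int,
  [/\ a1 * d1 - b1 * c1 = 1 \/ a1 * d1 - b1 * c1 = -1,
      forall F : int -> int -> C, aff a1 b1 c1 d1 e1 e1' (aff a b c d e e' F) = F,
      forall F : int -> int -> C, aff a b c d e e' (aff a1 b1 c1 d1 e1 e1' F) = F &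
      (a1 * a + b1 * c = 1 /\ a1 * b + b1 * d = 0) /\ (c1 * a + d1 * c = 0 /\ c1 * b + d1 * d = 1)].
Proof.
move=> H; set D := a * d - b * c in H.
have DD : D * D = 1 by case: H => ->.
exists (D * d), (- (D * b)), (- (D * c)), (D * a), (- D * (d * e - b * e')), (- D * (a * e' - c * e)).
have i1 : a * (D * d) + b * - (D * c) = 1 by rewrite -DD /D; ring.
have i2 : a * - (D * b) + b * (D * a) = 0 by ring.
have i3 : c * (D * d) + d * - (D * c) = 0 by ring.
have i4 : c * - (D * b) + d * (D * a) = 1 by rewrite -DD /D; ring.
have j1 : D * d * a + - (D * b) * c = 1 by rewrite -DD /D; ring.
have j2 : D * d * b + - (D * b) * d = 0 by ring.
have j3 : - (D * c) * a + D * a * c = 0 by ring.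
have j4 : - (D * c) * b + D * a * d = 1 by rewrite -DD /D; ring.
split => //.
- have -> : D * d * (D * a) - - (D * b) * - (D * c) = D * D * D by rewrite {5}/D; ring.
  by rewrite DD mul1r.
- move=> F; rewrite aff_aff i1 i2 i3 i4.
  have -> : a * (- D * (d * e - b * e')) + b * (- D * (a * e' - c * e)) + e = e - D * D * e by rewrite {4}/D; ring.
  have -> : c * (- D * (d * e - b * e')) + d * (- D * (a * e' - c * e)) + e' = e' - D * D * e' by rewrite {4}/D; ring.
  by rewrite DD !mul1r !subrr aff_id.
- move=> F; rewrite aff_aff j1 j2 j3 j4.
  have -> : D * d * e + - (D * b) * e' + - D * (d * e - b * e') = 0 by ring.
  have -> : - (D * c) * e + D * a * e' + - D * (a * e' - c * e) = 0 by ring.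
  exact: aff_id.
Qed.

Lemma mut_orbit_class (f0 : laurent R) : mutation_class (mut_orbit f0).
Proof.
split.
- by move=> F [l [a [b [c [d [e [e' [_ _ D ->]]]]]]]]; apply: fin_aff D (coefA_fin l).
- move=> F [l [a [b [c [d [e [e' [_ [n ln] D ->]]]]]]]].
  have [a1 [b1 [c1 [d1 [e1 [e1' [_ I _ _]]]]]]] := aff_inv e e' D.
  exists (a1 * n.1 + b1 * n.2 + e1), (c1 * n.1 + d1 * n.2 + e1').
  have := congr1 (fun G => G n.1 n.2) (I (coefA l)); rewrite {1}/aff => ->.
  by rewrite /coefA -surjective_pairing.
- move=> F a1 b1 c1 d1 e1 e1' [l [a [b [c [d [e [e' [me nl D ->]]]]]]]] D1.
  rewrite aff_aff; exists l; do 6 eexists; split; [exact: me|exact: nl| |reflexivity].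
  have -> : (a * a1 + b * c1) * (c * b1 + d * d1) - (a * b1 + b * d1) * (c * a1 + d * c1)
    = (a * d - b * c) * (a1 * d1 - b1 * c1) by ring.
  by case: D => ->; case: D1 => ->; rewrite ?mul1r ?mulN1r ?opprK; auto.
move=> F G p q k u v [l [a [b [c [d [e [e' [me [n ln] D ->]]]]]]]] fG puv pu pq Rel.
have [a1 [b1 [c1 [d1 [e1 [e1' [D1 I1 I2 [[J1 J2] [J3 J4]]]]]]]]] := aff_inv e e' D.
pose u' := a * u + b * v; pose v' := c * u + d * v.
have eu : a1 * u' + b1 * v' = u.
  have -> : a1 * u' + b1 * v' = (a1 * a + b1 * c) * u + (a1 * b + b1 * d) * v by rewrite /u' /v'; ring.
  by rewrite J1 J2 mul1r mul0r addr0.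
have ev : c1 * u' + d1 * v' = v.
  have -> : c1 * u' + d1 * v' = (c1 * a + d1 * c) * u + (c1 * b + d1 * d) * v by rewrite /u' /v'; ring.
  by rewrite J3 J4 mul1r mul0r add0r.
(* Undo the affine change, so that the mutation acts on the Laurent polynomial [l] itself. *)
pose G1 := aff a1 b1 c1 d1 e1 e1' G.
have fG1 : finite_supp G1 by apply: fin_aff.
have R1 : mutation_rel (coefA l) G1 (p * a1 + q * c1) (p * b1 + q * d1) (k + p * e1 + q * e1') u' v'.
  by rewrite -(I1 (coefA l)); apply: mutation_rel_aff; rewrite eu ev.
have puv' : unimodular u' v'.
  case: puv => [s [t E]]; exists (s * a1 + t * c1), (s * b1 + t * d1).
  rewrite -E -[in RHS]eu -[in RHS]ev; ring.
have pe : (p * a1 + q * c1) * u' + (p * b1 + q * d1) * v' = 0.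
  by rewrite -pu -[in RHS]eu -[in RHS]ev; ring.
have pq' : (p * a1 + q * c1 != 0) || (p * b1 + q * d1 != 0).
  apply/negPn/negP; rewrite negb_or !negbK => /andP [/eqP h1 /eqP h2].
  have hp : p * (a1 * d1 - b1 * c1) = (p * a1 + q * c1) * d1 - (p * b1 + q * d1) * c1 by ring.
  have hq : q * (a1 * d1 - b1 * c1) = (p * b1 + q * d1) * a1 - (p * a1 + q * c1) * b1 by ring.
  move: hp hq; rewrite h1 h2 !mul0r subrr.
  by case: D1 => ->; rewrite ?mulr1 ?mulrN1 => hp hq; move: pq; clear -hp hq; lia.
have [l' [st El']] := mut_step_of_murel fG1 puv' pe pq' R1.
have EG : G = aff a b c d e e' (coefA l').
  rewrite -(I2 G) -/G1; congr aff.
  by apply/funext => x; apply/funext => y; rewrite /coefA El'.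
exists l', a, b, c, d, e, e'; split => //; first exact: mut_equiv_rcons me st.
have fF : finite_supp (aff a b c d e e' (coefA l)) by apply: fin_aff D (coefA_fin l).
have [x [y hxy]] : exists x y, aff a b c d e e' (coefA l) x y != 0.
  exists (a1 * n.1 + b1 * n.2 + e1), (c1 * n.1 + d1 * n.2 + e1').
  have := congr1 (fun G => G n.1 n.2) (I1 (coefA l)); rewrite {1}/aff => ->.
  by rewrite /coefA -surjective_pairing.
have puN : - p * u + - q * v = 0 by rewrite !mulNr -opprD pu oppr0.
have [[s hs] _] := mutation_rel_supp fF (unimodular_neq0 puv) puN (mutation_rel_sym Rel) hxy.
by move: hs; rewrite EG => hs; eexists; exact: hs.
Qed.

Lemma unimodular_aff (p q a b c d : int) : a * d - b * c = 1 \/ a * d - b * c = -1 -> unimodular p q ->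
  unimodular (p * a + q * c) (p * b + q * d).
Proof.
move=> D [u [v E]]; pose k := a * d - b * c.
exists (k * (u * d - v * b)), (k * (v * a - u * c)).
have -> : k * (u * d - v * b) * (p * a + q * c) + k * (v * a - u * c) * (p * b + q * d)
  = k * k * (u * p + v * q) by rewrite {4}/k; ring.
by rewrite E mulr1 /k; case: D => ->.
Qed.

Lemma mults_ok_orbit (l : laurent R) (a b c d e e' v1 v2 p q k : int) :
  a * d - b * c = 1 \/ a * d - b * c = -1 -> mults_ok (aff a b c d e e' (coefA l)) v1 v2 ->
  unimodular p q -> has_mult (coefA l) p q k ->
  p * (a * v1 + b * v2 + e) + q * (c * v1 + d * v2 + e') + k <= 0.
Proof.
move=> D ok pq L; have := ok _ _ _ (unimodular_aff D pq) (has_mult_aff e e' D L).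
by congr (_ <= 0); ring.
Qed.

Lemma unimodular_reduce (p q : int) : (p != 0) || (q != 0) ->
  exists g p' q' : int, [/\ 0 < g, p = g * p', q = g * q' & unimodular p' q'].
Proof.
move=> pq; pose g := gcdz p q.
have g0 : g != 0 by rewrite /g gcdz_eq0 negb_and.
have gp : 0 < g by rewrite lt_neqAle eq_sym g0 /g /gcdz.
have ep : p = g * (p %/ g)%Z by rewrite mulrC divzK // dvdz_gcdl.
have eq : q = g * (q %/ g)%Z by rewrite mulrC divzK // dvdz_gcdr.
exists g, (p %/ g)%Z, (q %/ g)%Z; split => //.
have [u [v E]] := Bezoutz p q; exists u, v; apply: (mulfI g0).
by rewrite mulr1 -[RHS]E mulrDr [in RHS]ep [in RHS]eq; ring.
Qed.

(** Reduction to primitive linear part. If the linear part of [m] is [g] times a primitive one, the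
    row at height [i + 1] of the primitive form with value [1] at [v] has [phi_m]-height
    [g i + phi m v >= i + 1]. *)
Lemma mutable_has_mult (l : laurent R) (m : latMt) (v : latN) : m_mutable m l -> 0 < phi m v ->
  exists p q : int, unimodular p q /\ has_mult (coefA l) p q (1 - p * v.1 - q * v.2).
Proof.
move=> mm mv; have [e1 [e2 [pe perp m0 [G fG H]]]] := mutable_has_mult_dir mm.
have [g [p [q [g0 Ep Eq pq]]]] := unimodular_reduce m0.
have pp : p * e1 + q * e2 = 0.
  have /eqP : g * (p * e1 + q * e2) = 0 by rewrite -perp Ep Eq; ring.
  by rewrite mulf_eq0 (gt_eqF g0) /= => /eqP.
exists p, q; split => //.
set c := 1 - p * v.1 - q * v.2.
have L : has_mult_dir (coefA l) p q c e1 e2.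
  pose G' x y := mulpn e1 e2 (absz ((m.1.1 - p) * x + (m.1.2 - q) * y + (m.2 - c))) G x y.
  exists G'.
    apply: (@fin_patch _ G G' (m.1.1 - p) (m.1.2 - q) (m.2 - c) e1 e2) => //.
      have -> : (m.1.1 - p) * e1 + (m.1.2 - q) * e2 = m.1.1 * e1 + m.1.2 * e2 - (p * e1 + q * e2) by ring.
      by rewrite perp pp subr0.
    by move=> x y /mulpn_supp [j hj hG]; exists j%:Z; split => //; lia.
  move=> x y i E.
  have Em : m.1.1 * x + m.1.2 * y + m.2 = g * i%:Z + phi m v.
    have -> : g * i%:Z = g * (i.+1%:Z - 1) by rewrite intS addrC addKr.
    by rewrite -E /phi /pairing /c Ep Eq; ring.
  have gi : i%:Z <= g * i%:Z by apply: mul_ge_l => //; lia.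
  pose N := absz (m.1.1 * x + m.1.2 * y + m.2).
  have N1 : (i < N)%N by rewrite /N Em; clear -gi mv; lia.
  have NE : N%:Z = m.1.1 * x + m.1.2 * y + m.2 by rewrite /N Em; clear -gi mv; lia.
  have D0 : absz ((m.1.1 - p) * x + (m.1.2 - q) * y + (m.2 - c)) = (N - i.+1)%N.
    have -> : (m.1.1 - p) * x + (m.1.2 - q) * y + (m.2 - c) = (m.1.1 * x + m.1.2 * y + m.2) - (p * x + q * y + c) by ring.
    by rewrite E -NE; clear -N1; lia.
  rewrite (H x y N.-1); last by rewrite -NE; clear -N1; lia.
  have -> : N.-1.+1 = (i.+1 + (N - i.+1))%N by clear -N1; lia.
  rewrite mulpnD; apply: mulpn_ext => j _; rewrite /G'.
  have -> : (m.1.1 - p) * (x - e1 * j%:Z) + (m.1.2 - q) * (y - e2 * j%:Z) + (m.2 - c) =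
    (m.1.1 - p) * x + (m.1.2 - q) * y + (m.2 - c) - ((m.1.1 * e1 + m.1.2 * e2) - (p * e1 + q * e2)) * j%:Z by ring.
  by rewrite perp pp subrr mul0r subr0 D0.
(* [(q, -p)] and [(e1, e2)] are primitive and orthogonal to [(p, q)], so they agree up to sign. *)
have [s [h1 h2]] : exists s : int, q = s * e1 /\ - p = s * e2.
  case: pe => s [t E]; exists (s * q - t * p).
  have k1 : q - (s * q - t * p) * e1 = 0.
    have -> : q - (s * q - t * p) * e1 = q * (1 - (s * e1 + t * e2)) + t * (p * e1 + q * e2) by ring.
    by rewrite E pp subrr !mulr0 addr0.
  have k2 : - p - (s * q - t * p) * e2 = 0.
    have -> : - p - (s * q - t * p) * e2 = - p * (1 - (s * e1 + t * e2)) - s * (p * e1 + q * e2) by ring.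
    by rewrite E pp subrr !mulr0 subr0.
  by split; apply/eqP; rewrite -subr_eq0 ?k1 ?k2.
have s1 : s = 1 \/ s = -1.
  case: pq => u [t E]; apply: (@int_mul1 (t * e1 - u * e2)).
  by rewrite -E -[p]opprK h2 h1; ring.
case: s1 => es; rewrite es ?mul1r ?mulN1r in h1 h2; rewrite /has_mult.
  by move: L; rewrite -h1 -h2.
by move/(has_mult_dir_rev pp): L; rewrite -h1 -h2.
Qed.

End Final.

Theorem theorem7p5 (R : realType) (f : laurent R) :
  (exists n : latN, coef f n != 0) -> normalized f ->
  exists g : laurent R, mut_equiv f g /\
    exists v : latN, newton g (toR R v) /\
      forall m : latMt, m_mutable m g -> phi m v <= 0.
Proof.
move=> nz _.
have K0 : mut_orbit f (coefA f).
  exists f, 1, 0, 0, 1, 0, 0; split => //; [exact: mut_refl|by left|by rewrite aff_id].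
have [_ [v1 [v2 [[l [a [b [c [d [e [e' [me [n0 ln0] D ->]]]]]]]] ok]]]] :=
  mutation_class_solved (mut_orbit_class f) (ex_intro _ _ K0).
exists l; split => //.
pose v : latN := (a * v1 + b * v2 + e, c * v1 + d * v2 + e').
have main p q k : unimodular p q -> has_mult (coefA l) p q k -> p * v.1 + q * v.2 + k <= 0.
  exact: mults_ok_orbit.
have supp n : coef l n != 0 -> n \in suppl l.
  move=> h; have /mapP [r rl er] := coef_mem h; rewrite /suppl er; apply: map_f.
  by rewrite mem_filter rl andbT -er.
exists v; split.
  apply: in_conv_sep => p q.
  have [pq|] := boolP ((p != 0) || (q != 0)); last first.
    rewrite negb_or !negbK => /andP [/eqP -> /eqP ->].
    by exists n0; [exact: supp|rewrite !mul0r].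
  have [g [p' [q' [g0 -> -> pq']]]] := unimodular_reduce pq.
  apply: contrapT => H.
  (* A separating form is at most its value at [v] minus one on the support, so this multiplicity is
     vacuous, yet its value at [v] is [1]. *)
  suff : has_mult (coefA l) p' q' (1 - p' * v.1 - q' * v.2).
    by move/(main _ _ _ pq'); move: (p' * v.1) (q' * v.2); clear; lia.
  apply: has_mult_nonpos => x y h; rewrite leNgt; apply/negP => hh; apply: H.
  exists (x, y); first exact: supp.
  rewrite /= -!mulrA -!mulrDr ler_pM2l //.
  by move: (p' * v.1) (q' * v.2) hh; clear; lia.
move=> m mm; rewrite leNgt; apply/negP => mv.
have [p [q [pq L]]] := mutable_has_mult mm mv.
by have := main _ _ _ pq L; move: (p * v.1) (q * v.2); clear; lia.
Qed.
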